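(* Let $X$ be a Euclidean polyhedral space, $U\subset X$ open, and $\Pi$ a polyhedral complex on $X$ such that $\Pi|_U$ is finite. Then there is a subdivision $\Pi'$ of $\Pi$ such that for every piecewise affine function $g$ on $U$ defined on $\Pi'$ there are concave piecewise affine functions $f_1,f_2$ on $U$ defined on $\Pi'$ with $g=f_1-f_2$.
   Context: Polyhedral spaces. Let $X$ be a second countable topological space. A polyhedral structure $\Pi$ on $X$ is a locally finite covering of $X$ by distinct closed subsets $\sigma$ (polyhedra), each with a finite-dimensional vector space $M_\sigma$ of continuous real functions on $\sigma$ such that, with $N_\sigma=\operatorname{Hom}(M_\sigma,\mathbb{R})$, the evaluation map $\phi_\sigma\colon\sigma\to N_\sigma$ is a homeomorphism onto a full-dimensional convex polyhedron of an affine hyperplane of $N_\sigma$ not containing $0$. Faces of $\sigma$ are preimages of faces of $\phi_\sigma(\sigma)$ (including the empty face); every face of a polyhedron is a polyhedron of $\Pi$ with function space the restrictions of $M_\sigma$; any two polyhedra meet in a common face. Each polyhedron has an affine structure, dimension, facets. $\Pi'$ subdivides $\Pi$ if each polyhedron of $\Pi'$ lies in one of $\Pi$ with affine inclusion; structures are equivalent if they have a common subdivision. A polyhedral space is $X$ with an equivalence class of structures; a polyhedral complex on $X$ is a member. $\tau\prec\sigma$ means $\tau$ is a face of $\sigma$. A Euclidean polyhedral space is a polyhedral space $X$ with a finite-dimensional Euclidean vector space $N_X$ and a map $\iota\colon X\to N_X$ with image in an affine hyperplane $H_X\not\ni0$ such that some polyhedral complex has $\iota$ injective and affine on each polyhedron;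 only such complexes are considered. For a nonempty facet $\tau$ of $\sigma$, $v_{\sigma\setminus\tau}$ is the unit vector orthogonal to the affine span of $\iota(\tau)$, parallel to that of $\iota(\sigma)$, pointing towards $\iota(\sigma)$. For $V$ open, $\Pi|_V$ is the set of polyhedra meeting $V$, $\Pi|_V(k)$ those of dimension $k$. A $k$-dimensional weight $c\colon\Pi|_V(k)\to\mathbb{R}$ is positive if $c\ge0$, a Minkowski weight if $\sum_{\sigma\in\Pi|_V(k),\sigma\succ\tau}c(\sigma)v_{\sigma\setminus\tau}=0$ for every $\tau\in\Pi|_V(k-1)$. A piecewise affine function on $V$ defined on $\Pi$ is $f\colon V\to\mathbb{R}$ affine on each $\sigma\cap V$, $\sigma\in\Pi|_V$; write $f=f_\sigma\circ\iota$ there with $f_\sigma$ linear; $(f\cdot c)(\tau)=-\sum_{\sigma\succ\tau}c(\sigma)f_\sigma(v_{\sigma\setminus\tau})$. Minkowski cycles are Minkowski weights modulo pullback to subdivisions ($c_{\Pi'}(\sigma')=c(\sigma)$ if $\sigma'\subset\sigma$ with the same dimension, else $0$); positive if represented by a positive Minkowski weight; $f\cdot[c]=[f\cdot c]$. A piecewise affine $f$ on $U$ is concave if for every open $V\subset U$ and every positive Minkowski cycle $\gamma$ on $V$, $f\cdot\gamma$ is positive. *)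

(* Defs.v *)
From HB Require Import structures.
From mathcomp Require Import all_boot all_order all_algebra.
From mathcomp Require Import all_classical all_reals all_analysis.
From Stdlib Require Import Relations.
Set Implicit Arguments.
Unset Strict Implicit.
Unset Printing Implicit Defensive.
Import Order.TTheory GRing.Theory Num.Theory.
Import numFieldNormedType.Exports.
Local Open Scope classical_set_scope.
Local Open Scope ring_scope.

(** The Euclidean vector space N_X is modelled as 'rV[R]_n with the standard
    inner product [dotv]. *)
Definition dotv {R : realType} {n : nat} (u v : 'rV[R]_n) : R :=
  \sum_(i < n) u ord0 i * v ord0 i.

Definition is_polyhedron {R : realType} {n : nat} (P : set 'rV[R]_n) : Prop :=
  exists s : seq ('rV[R]_n * R),
    P = [set y | forall ab, ab \in s -> dotv ab.1 y <= ab.2].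

(** tau is a face of sigma: preimage under iota|sigma of a face
    (intersection with a supporting hyperplane, incl. the whole polyhedron
    and the empty face) of iota(sigma). *)
Definition face {R : realType} {X : Type} {n : nat} (iota : X -> 'rV[R]_n)
  (tau sigma : set X) : Prop :=
  exists (w : 'rV[R]_n) (c : R),
    (forall x, sigma x -> dotv w (iota x) <= c) /\
    tau = [set x | sigma x /\ dotv w (iota x) = c].

Definition diffs {R : realType} {n : nat} (S : set 'rV[R]_n) : set 'rV[R]_n :=
  [set v | exists p q, S p /\ S q /\ v = p - q].

Definition in_dir {R : realType} {n : nat} (S : set 'rV[R]_n) (v : 'rV[R]_n)
  : Prop :=
  exists s : seq 'rV[R]_n, (forall u, u \in s -> diffs S u) /\ v \in (vector.span s).

Definition has_dim {R : realType} {n : nat} (S : set 'rV[R]_n) (k : nat)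
  : Prop :=
  exists s : seq 'rV[R]_n, size s = k /\ free s /\
    (forall u, u \in s -> diffs S u) /\
    (forall u, diffs S u -> u \in (vector.span s)).

Definition pdim {R : realType} {X : Type} {n : nat} (iota : X -> 'rV[R]_n)
  (sigma : set X) (k : nat) : Prop :=
  sigma !=set0 /\ has_dim (iota @` sigma) k.

Definition hom_onto_image {R : realType} {X : topologicalType} {n : nat}
  (iota : X -> 'rV[R]_n) (sigma : set X) : Prop :=
  (forall x y, sigma x -> sigma y -> iota x = iota y -> x = y) /\
  {within sigma, continuous iota} /\
  (forall A : set X, open A ->
     exists B : set 'rV[R]_n, open B /\ iota @` (A `&` sigma) = B `&` iota @` sigma).

(** Pi is a polyhedral complex on X on which iota is injective and affine on
    every polyhedron (the affine structure of sigma being given by the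
    functions l o iota, l linear). *)
Definition is_cx {R : realType} {X : topologicalType} {n : nat}
  (iota : X -> 'rV[R]_n) (Pi : set (set X)) : Prop :=
  [/\ (forall x, exists sigma, Pi sigma /\ sigma x),
      (forall x : X, exists N, nbhs x N /\
          finite_set [set sigma | Pi sigma /\ sigma `&` N !=set0]),
      (forall sigma, Pi sigma ->
          [/\ closed sigma, hom_onto_image iota sigma &
              is_polyhedron (iota @` sigma)]),
      (forall sigma tau, Pi sigma -> face iota tau sigma -> Pi tau) &
      (forall sigma sigma', Pi sigma -> Pi sigma' ->
          face iota (sigma `&` sigma') sigma /\
          face iota (sigma `&` sigma') sigma')].

(** Pi' subdivides Pi (affine inclusion is automatic, both structures being
    induced by iota) *)
Definition subdivides {R : realType} {X : topologicalType} {n : nat}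
  (iota : X -> 'rV[R]_n) (Pi' Pi : set (set X)) : Prop :=
  [/\ is_cx iota Pi', is_cx iota Pi &
      forall sigma', Pi' sigma' -> exists sigma, Pi sigma /\ sigma' `<=` sigma].

Definition same_space {R : realType} {X : topologicalType} {n : nat}
  (iota : X -> 'rV[R]_n) (Pi0 Pi1 : set (set X)) : Prop :=
  clos_refl_sym_trans (set (set X)) (fun A B => subdivides iota B A) Pi0 Pi1.

Definition restr {R : realType} {X : Type} {n : nat} (iota : X -> 'rV[R]_n)
  (Pi : set (set X)) (V : set X) (k : nat) : set (set X) :=
  [set sigma | Pi sigma /\ sigma `&` V !=set0 /\ pdim iota sigma k].

Definition normal_prop {R : realType} {X : Type} {n : nat}
  (iota : X -> 'rV[R]_n) (sigma tau : set X) (v : 'rV[R]_n) : Prop :=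
  [/\ dotv v v = 1, in_dir (iota @` sigma) v,
      (forall u, diffs (iota @` tau) u -> dotv v u = 0) &
      (forall x y, sigma x -> tau y -> 0 <= dotv v (iota x - iota y))].

Definition nvec {R : realType} {X : Type} {n : nat} (iota : X -> 'rV[R]_n)
  (sigma tau : set X) : 'rV[R]_n :=
  xget 0 (normal_prop iota sigma tau).

Definition is_minkowski {R : realType} {X : Type} {n : nat}
  (iota : X -> 'rV[R]_n) (Pi : set (set X)) (V : set X) (k : nat)
  (c : set X -> R) : Prop :=
  forall j tau, k = j.+1 -> restr iota Pi V j tau ->
    \sum_(sigma \in [set sigma | restr iota Pi V k sigma /\ face iota tau sigma])
       (c sigma *: nvec iota sigma tau) = 0.

Definition positive_weight {R : realType} {X : Type} {n : nat}
  (iota : X -> 'rV[R]_n) (Pi : set (set X)) (V : set X) (k : nat)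
  (c : set X -> R) : Prop :=
  forall sigma, restr iota Pi V k sigma -> 0 <= c sigma.

Definition is_pa {R : realType} {X : Type} {n : nat} (iota : X -> 'rV[R]_n)
  (Pi : set (set X)) (V : set X) (f : X -> R) : Prop :=
  forall sigma, Pi sigma -> sigma `&` V !=set0 ->
    exists w : 'rV[R]_n, forall x, sigma x -> V x -> f x = dotv w (iota x).

Definition lin_part {R : realType} {X : Type} {n : nat} (iota : X -> 'rV[R]_n)
  (V : set X) (f : X -> R) (sigma : set X) : 'rV[R]_n :=
  xget 0 [set w | forall x, sigma x -> V x -> f x = dotv w (iota x)].

Definition pa_mult {R : realType} {X : Type} {n : nat} (iota : X -> 'rV[R]_n)
  (Pi : set (set X)) (V : set X) (k : nat) (f : X -> R) (c : set X -> R)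
  : set X -> R :=
  fun tau => - \sum_(sigma \in [set sigma | restr iota Pi V k.+1 sigma /\
                                           face iota tau sigma])
                 (c sigma * dotv (lin_part iota V f sigma) (nvec iota sigma tau)).

Definition is_pullback {R : realType} {X : topologicalType} {n : nat}
  (iota : X -> 'rV[R]_n) (V : set X) (k : nat)
  (Pi : set (set X)) (c : set X -> R) (Pi' : set (set X)) (c' : set X -> R)
  : Prop :=
  subdivides iota Pi' Pi /\
  forall sigma', restr iota Pi' V k sigma' ->
    (exists sigma, [/\ Pi sigma, pdim iota sigma k, sigma' `<=` sigma &
                       c' sigma' = c sigma]) \/
    ((~ exists sigma, [/\ Pi sigma, pdim iota sigma k & sigma' `<=` sigma]) /\
     c' sigma' = 0).

Definition cyc_equiv {R : realType} {X : topologicalType} {n : nat}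
  (iota : X -> 'rV[R]_n) (V : set X) (k : nat) :
  Relation_Definitions.relation (set (set X) * (set X -> R)) :=
  clos_refl_sym_trans _ (fun p q => is_pullback iota V k p.1 p.2 q.1 q.2).

Definition pos_cycle {R : realType} {X : topologicalType} {n : nat}
  (iota : X -> 'rV[R]_n) (V : set X) (k : nat)
  (Pi : set (set X)) (c : set X -> R) : Prop :=
  exists Pi2 c2, [/\ cyc_equiv iota V k (Pi, c) (Pi2, c2),
                     is_minkowski iota Pi2 V k c2 &
                     positive_weight iota Pi2 V k c2].

Definition concave_pa {R : realType} {X : topologicalType} {n : nat}
  (iota : X -> 'rV[R]_n) (Pi0 : set (set X)) (U : set X) (f : X -> R) : Prop :=
  forall (V : set X), open V -> V `<=` U ->
  forall (k : nat) (Pi1 : set (set X)) (c : set X -> R),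
    same_space iota Pi0 Pi1 -> is_pa iota Pi1 V f ->
    is_minkowski iota Pi1 V k.+1 c -> pos_cycle iota V k.+1 Pi1 c ->
    pos_cycle iota V k Pi1 (pa_mult iota Pi1 V k f c).

(* Main.v *)
(** The polyhedra of Pi meeting U are cut out by finitely many affine
    inequalities, i.e. (as iota takes values in a hyperplane avoiding 0) by
    finitely many linear forms H_i on the ambient space.  Pi' is the subdivision
    of Pi by the arrangement of the hyperplanes H_i = 0, and
    F = - \sum_i |H_i o iota| is affine on its cells.  At x in U, two linear
    pieces of a function g defined on Pi' differ by a combination of the H_i
    vanishing at x, because any small displacement killing these H_i stays in
    every cell containing x.  Hence for C large, g + C F is dominated at every
    x, along all segments issuing from x, by one linear function.  By balancing
    this makes (g + C F) . c nonnegative for every positive Minkowski weight c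
    on any complex, so g + C F is concave; so is C F, and g = (g + C F) - C F.

    That f . c is again balanced comes from the two facets between a polyhedron
    and a face of codimension two; that positivity of c may be read off on any
    representative of its class, from the existence of full-dimensional cells
    in subdivisions. *)
Require Import Defs.
From HB Require Import structures.
From mathcomp Require Import all_boot all_order all_algebra.
From mathcomp Require Import all_classical all_reals all_analysis.
From mathcomp Require Import ring lra.
From Stdlib Require Import Relations.
Set Implicit Arguments.
Unset Strict Implicit.
Unset Printing Implicit Defensive.
Import Order.TTheory GRing.Theory Num.Theory.
Import numFieldNormedType.Exports.
Local Open Scope classical_set_scope.
Local Open Scope ring_scope.

(** * Inner product, spans and orthogonal projection *)

Section DotProduct.
Variables (R : realType) (n : nat).
Implicit Types (u v w p q x y : 'rV[R]_n) (s : seq 'rV[R]_n) (a t : R).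

(** Concavity is tested against every complex equivalent to [Pi], and such a complex need not be
    comparable with the refinement. Germs of straight segments replace common subdivisions: a curve
    in [X] that starts as a segment for one complex does so for all equivalent ones, so a domination
    condition along germs is checked on the refinement and used on any complex. The segments live in
    [X] and not in the vector space, because [iota] is injective only on single polyhedra.

    The linear form of [g] on a cell is a chosen one, determined only on the span of the image of
    the part of the cell in [U]. Two such forms at [x] differ by a combination of the active [H_i]
    and of the form [w0] that equals 1 on the image; [w0] vanishes along segments. The kink of [C F]
    at [x] contributes minus [C] times the sum of the absolute values of the active [H_i], which
    absorbs the difference. One [C] serves all points: [x] enters only through two cells and a set
    of active indices, and these are finite in number. *)

Lemma dotvC u v : dotv u v = dotv v u.
Proof. by apply: eq_bigr => i _; rewrite mulrC. Qed.

Lemma dotvDr u v w : dotv u (v + w) = dotv u v + dotv u w.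
Proof. by rewrite -big_split; apply: eq_bigr => i _; rewrite mxE mulrDr. Qed.

Lemma dotvZr u a v : dotv u (a *: v) = a * dotv u v.
Proof. by rewrite mulr_sumr; apply: eq_bigr => i _; rewrite mxE mulrCA. Qed.

Lemma dotvDl u v w : dotv (u + v) w = dotv u w + dotv v w.
Proof. by rewrite !(dotvC _ w) dotvDr. Qed.

Lemma dotvZl u a v : dotv (a *: u) v = a * dotv u v.
Proof. by rewrite !(dotvC _ v) dotvZr. Qed.

Lemma dotv0r u : dotv u 0 = 0.
Proof. by rewrite -(scale0r 0) dotvZr mul0r. Qed.

Lemma dotv0l u : dotv 0 u = 0.
Proof. by rewrite dotvC dotv0r. Qed.

Lemma dotvNr u v : dotv u (- v) = - dotv u v.
Proof. by rewrite -scaleN1r dotvZr mulN1r. Qed.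

Lemma dotvNl u v : dotv (- u) v = - dotv u v.
Proof. by rewrite !(dotvC _ v) dotvNr. Qed.

Lemma dotvBr u v w : dotv u (v - w) = dotv u v - dotv u w.
Proof. by rewrite dotvDr dotvNr. Qed.

Lemma dotvBl u v w : dotv (u - v) w = dotv u w - dotv v w.
Proof. by rewrite dotvDl dotvNl. Qed.

Lemma dotv_sumr (I : Type) (r : seq I) (P : pred I) (F : I -> 'rV[R]_n) u :
  dotv u (\sum_(i <- r | P i) F i) = \sum_(i <- r | P i) dotv u (F i).
Proof.
by elim/big_rec2: _ => [|i y1 y2 _ <-]; [exact: dotv0r | exact: dotvDr].
Qed.

Lemma dotv_suml (I : Type) (r : seq I) (P : pred I) (F : I -> 'rV[R]_n) u :
  dotv (\sum_(i <- r | P i) F i) u = \sum_(i <- r | P i) dotv (F i) u.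
Proof. by rewrite dotvC dotv_sumr; apply: eq_bigr => i _; rewrite dotvC. Qed.

Lemma dotv_ge0 u : 0 <= dotv u u.
Proof. by apply: sumr_ge0 => i _; rewrite -expr2 sqr_ge0. Qed.

Lemma dotv_eq0 u : (dotv u u == 0) = (u == 0).
Proof.
apply/eqP/eqP => [u0|->]; last exact: dotv0l.
apply/rowP => i; rewrite mxE; apply/eqP.
rewrite -sqrf_eq0 expr2; apply/eqP; move: i (erefl true).
by apply: psumr_eq0P u0 => i _; rewrite -expr2 sqr_ge0.
Qed.

Lemma dotv_gt0 u : u != 0 -> 0 < dotv u u.
Proof. by move=> u0; rewrite lt_def dotv_eq0 u0 dotv_ge0. Qed.

Lemma span_ind (P : 'rV[R]_n -> Prop) s :
  P 0 -> (forall u v, P u -> P v -> P (u + v)) ->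
  (forall a u, P u -> P (a *: u)) -> (forall u, u \in s -> P u) ->
  forall v, v \in vector.span s -> P v.
Proof.
move=> P0 PD PZ; elim: s => [|b s IH] Ps v.
  by rewrite span_nil memv0 => /eqP ->.
rewrite span_cons => /memv_addP[u /vlineP[k ->] [u' u's ->]].
apply: PD; first by apply: PZ; apply: Ps; rewrite mem_head.
by apply: IH u's => z zs; apply: Ps; rewrite in_cons zs orbT.
Qed.

(** One step of Gram-Schmidt per generator: [c] is the part of [b] orthogonal to the span of [s],
    and the projection grows by the component of [w] along [c]. If [c] is 0, division by zero gives
    the coefficient 0, which is harmless. *)
Lemma orth_proj_span s w : exists2 p, p \in vector.span s &
  forall u, u \in vector.span s -> dotv w u = dotv p u.
Proof.
elim: s w => [|b s IH] w.
  exists 0; first exact: mem0v.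
  by move=> u; rewrite span_nil memv0 => /eqP ->; rewrite !dotv0r.
have [b1 b1s hb1] := IH b; have [p ps hp] := IH w.
have sub z : z \in vector.span s -> z \in vector.span (b :: s).
  by apply/subvP; rewrite span_cons addvSr.
have bin : b \in vector.span (b :: s) by apply: memv_span; rewrite mem_head.
set c := b - b1.
have cs z : z \in vector.span s -> dotv c z = 0.
  by move=> zs; rewrite dotvBl hb1 // subrr.
have cin : c \in vector.span (b :: s) by rewrite memvB // sub.
exists (p + (dotv w c / dotv c c) *: c).
  by rewrite memvD ?memvZ // sub.
move=> u; rewrite span_cons => /memv_addP[u1 /vlineP[k ->] [u2 u2s ->]].
have -> : b = c + b1 by rewrite /c subrK.
have cc : dotv w c = dotv w c / dotv c c * dotv c c.
  have [/eqP|c0] := eqVneq (dotv c c) 0; last by rewrite divfK.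
  by rewrite dotv_eq0 => /eqP ->; rewrite !dotv0r mulr0.
clearbody c; rewrite scalerDr !dotvDr !dotvZr !dotvDl !dotvZl.
rewrite (cs _ b1s) (cs _ u2s) -cc (hp _ b1s) (hp _ u2s).
by rewrite [dotv p c]dotvC (cs _ ps); ring.
Qed.

Lemma orth_proj (L : {vspace 'rV[R]_n}) w : exists2 p, p \in L &
  forall u, u \in L -> dotv w u = dotv p u.
Proof. by rewrite -(span_basis (vbasisP L)); exact: orth_proj_span. Qed.

(** The residual [w - p] of the projection kills [s], hence is killed by [w] and by [p], hence by
    itself. This turns a statement about displacements into membership in a span. *)
Lemma orth_dual s w :
  (forall v, (forall u, u \in s -> dotv u v = 0) -> dotv w v = 0) ->
  w \in vector.span s.
Proof.
move=> ws; have [p ps hp] := orth_proj_span s w.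
have pw v : v \in vector.span s -> dotv (w - p) v = 0.
  by move=> vs; rewrite dotvBl hp // subrr.
suff /eqP : dotv (w - p) (w - p) = 0.
  by rewrite dotv_eq0 subr_eq0 => /eqP ->.
rewrite dotvBr (pw p) // subr0 [LHS]dotvC.
by apply: ws => u us; rewrite dotvC pw // memv_span.
Qed.

(** The constant is a sum of absolute values of coefficients; it is the origin of the factor [C] of
    the decomposition. *)
Lemma span_dotv_bound s w : w \in vector.span s ->
  exists2 C : R, 0 <= C &
    forall v, `|dotv w v| <= C * \sum_(u <- s) `|dotv u v|.
Proof.
move: w; apply: span_ind.
- by exists 0 => // v; rewrite dotv0l normr0 mul0r.
- move=> u1 u2 [C1 C10 h1] [C2 C20 h2]; exists (C1 + C2); first exact: addr_ge0.
  move=> v; rewrite dotvDl mulrDl; apply: le_trans (ler_normD _ _) _.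
  exact: lerD.
- move=> a u [C C0 h]; exists (`|a| * C); first exact: mulr_ge0.
  by move=> v; rewrite dotvZl normrM -mulrA ler_wpM2l.
- move=> u us; exists 1 => // v; rewrite mul1r.
  by rewrite (big_rem _ us) /= lerDl sumr_ge0.
Qed.

End DotProduct.

(** * Direction spaces, convexity and relative interior points *)

Section Directions.
Variables (R : realType) (n : nat).
Implicit Types (S : set 'rV[R]_n) (u v w p q x y : 'rV[R]_n).

(** A free family of differences is extended greedily; [k] bounds the number of extensions left,
    since no free family has more than [n] members. *)
Lemma diffs_basis_exists S : exists s : seq 'rV[R]_n,
  [/\ free s, forall u, u \in s -> diffs S u &
      forall u, diffs S u -> u \in vector.span s].
Proof.
suff H k (s : seq 'rV[R]_n) : free s -> (forall u, u \in s -> diffs S u) ->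
    (n <= size s + k)%N -> exists s : seq 'rV[R]_n,
    [/\ free s, forall u, u \in s -> diffs S u &
      forall u, diffs S u -> u \in vector.span s].
  by apply: (H n [::]) => //; exact: nil_free.
have fs (z : seq 'rV[R]_n) : free z -> (size z <= n)%N.
  move=> /eqP <-; apply: leq_trans (dimvS (subvf _)) _.
  by rewrite dimvf /dim /= mul1n.
elim: k s => [|k IH] s sf sd; have [sp|] := pselect
    (forall u, diffs S u -> u \in vector.span s); try by exists s.
- move=> /existsNP[u /not_implyP[du /negP us]]; rewrite addn0 => ns.
  have := fs (u :: s); rewrite free_cons us sf => /(_ isT) /=.
  by move=> /leq_trans/(_ ns); rewrite ltnn.
- move=> /existsNP[u /not_implyP[du /negP us]] ns.
  apply: (IH (u :: s)); first by rewrite free_cons us.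
    by move=> z; rewrite in_cons => /predU1P[->|/sd].
  by rewrite /= addSnnS.
Qed.

(** The linear space parallel to the affine span of [S]. The chosen basis is immaterial: this is the
    least subspace containing all differences of points of [S]. *)
Definition dirsp S : {vspace 'rV[R]_n} :=
  vector.span (projT1 (cid (diffs_basis_exists S))).

Lemma dirsp_sub S p q : S p -> S q -> p - q \in dirsp S.
Proof.
move=> Sp Sq; rewrite /dirsp; case: cid => s [_ _ h] /=; apply: h.
by exists p, q.
Qed.

Lemma dirsp_min S (L : {vspace 'rV[R]_n}) :
  (forall p q, S p -> S q -> p - q \in L) -> (dirsp S <= L)%VS.
Proof.
move=> h; rewrite /dirsp; case: cid => s [_ sd _] /=.
by apply/span_subvP => u /sd [p [q [Sp [Sq ->]]]]; exact: h.
Qed.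

Lemma dirsp_mono S (T : set 'rV[R]_n) : S `<=` T -> (dirsp S <= dirsp T)%VS.
Proof. by move=> ST; apply: dirsp_min => p q /ST Tp /ST; exact: dirsp_sub. Qed.

Lemma dirsp_ind S (P : 'rV[R]_n -> Prop) :
  P 0 -> (forall u v, P u -> P v -> P (u + v)) ->
  (forall a u, P u -> P (a *: u)) ->
  (forall p q, S p -> S q -> P (p - q)) -> forall v, v \in dirsp S -> P v.
Proof.
move=> P0 PD PZ PS; rewrite /dirsp; case: cid => s [_ sd _] /=.
by apply: span_ind => // u /sd [p [q [Sp [Sq ->]]]]; exact: PS.
Qed.

Lemma dotv_dirsp0 S w : (forall p q, S p -> S q -> dotv w p = dotv w q) ->
  forall v, v \in dirsp S -> dotv w v = 0.
Proof.
move=> h; apply: dirsp_ind.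
- exact: dotv0r.
- by move=> u1 u2 e1 e2; rewrite dotvDr e1 e2 addr0.
- by move=> k u e; rewrite dotvZr e mulr0.
- by move=> p q Sp Sq; rewrite dotvBr (h p q) // subrr.
Qed.

Lemma in_dirE S v : in_dir S v <-> v \in dirsp S.
Proof.
split=> [[s [sd]]|].
  apply/subvP/span_subvP => u /sd [p [q [Sp [Sq ->]]]]; exact: dirsp_sub.
by rewrite /dirsp; case: cid => s [_ sd _] /= vs; exists s.
Qed.

Lemma has_dimE S k : has_dim S k <-> \dim (dirsp S) = k.
Proof.
split=> [[s [<- [sf [sd sp]]]]|].
  have -> : dirsp S = vector.span s.
    apply/eqP; rewrite eqEsubv; apply/andP; split.
      by apply: dirsp_min => p q Sp Sq; apply: sp; exists p, q.
    by apply/span_subvP => u /sd [p [q [Sp [Sq ->]]]]; exact: dirsp_sub.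
  by move/eqP: sf.
rewrite /dirsp; case: cid => s [sf sd sp] /= <-; exists s; split => //.
by apply/esym/eqP.
Qed.

Definition convex S := forall p q (t : R), S p -> S q -> 0 <= t -> t <= 1 ->
  S (p + t *: (q - p)).

Lemma convex_ray S p v (a b : R) : convex S -> S (p + a *: v) ->
  S (p + b *: v) -> forall t, a <= t -> t <= b -> S (p + t *: v).
Proof.
move=> cS Sa Sb t ta tb; have [ab|] := ltrP a b; last first.
  by move=> ba; have -> : t = a by apply/eqP; rewrite eq_le ta (le_trans tb).
have := cS _ _ ((t - a) / (b - a)) Sa Sb.
have -> : p + a *: v + (t - a) / (b - a) *: (p + b *: v - (p + a *: v)) =
    p + t *: v.
  by apply/rowP => i; rewrite !mxE; field; rewrite subr_eq0 gt_eqF.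
apply; first by rewrite divr_ge0 ?subr_ge0 // ltW.
by rewrite ler_pdivrMr ?subr_gt0 // mul1r lerB.
Qed.

(** The relative interior of a convex set in radial form: there is room in every direction of the
    affine span. No topology is involved. *)
Definition relpt S x :=
  S x /\ forall v, v \in dirsp S -> exists2 d : R, 0 < d & S (x + d *: v).

(** Induction over a basis of differences. For a generator [b = p - q], the midpoint [m] of [p] and
    [q] has room along [b] both ways, [x] has room along the other generators, and the midpoint of
    [x] and [m] has both. *)
Lemma relpt_exists S : convex S -> S !=set0 -> exists x, relpt S x.
Proof.
move=> cS [x0 Sx0]; rewrite /relpt /dirsp; case: cid => s [_ sd _] /=.
elim: s sd => [|b s IH] sd.
  exists x0; split=> // v; rewrite span_nil memv0 => /eqP ->.
  by exists 1 => //; rewrite scaler0 addr0.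
have [x [Sx hx]] : exists x, S x /\ forall v, v \in vector.span s ->
    exists2 d : R, 0 < d & S (x + d *: v).
  by apply: IH => u us; apply: sd; rewrite in_cons us orbT.
have [p [q [Sp [Sq bpq]]]] := sd b (mem_head _ _).
pose m := p + 2^-1 *: (q - p).
have Sm : S m by apply: cS => //; lra.
exists (x + 2^-1 *: (m - x)); split; first by apply: cS => //; lra.
move=> v; rewrite span_cons => /memv_addP[u1 /vlineP[k ->] [u us ->]].
have [d d0 Sd] := hx _ us.
(* The second bound makes [e * k] at most one half in absolute value, which keeps [m + (e * k) *: b]
   between [p] and [q]. *)
pose e := Num.min d (2^-1 / (1 + `|k|)).
have k1 : 0 < 1 + `|k| by rewrite ltr_pwDl.
have e0 : 0 < e by rewrite lt_min d0 divr_gt0.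
exists (2^-1 * e); first by rewrite mulr_gt0.
have S1 : S (x + e *: u).
  apply: (convex_ray (a := 0) (b := d) cS) => //; last by rewrite ge_min lexx.
  - by rewrite scale0r addr0.
  - exact: ltW.
have ke : `|e * k| <= 2^-1.
  rewrite normrM gtr0_norm //; have : e <= 2^-1 / (1 + `|k|).
    by rewrite ge_min lexx orbT.
  rewrite ler_pdivlMr // => h; apply: le_trans h.
  by rewrite ler_pM2l // lerDr.
have S2 : S (m + (e * k) *: b).
  have -> : m + (e * k) *: b = p + (2^-1 - e * k) *: (q - p).
    by rewrite bpq /m; apply/rowP => i; rewrite !mxE; ring.
  by move: ke; rewrite ler_norml => /andP[h1 h2]; apply: cS => //; lra.
have := cS _ _ 2^-1 S1 S2.
have -> : x + e *: u + 2^-1 *: (m + (e * k) *: b - (x + e *: u)) =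
  x + 2^-1 *: (m - x) + 2^-1 * e *: (k *: b + u).
  by apply/rowP => i; rewrite !mxE; field.
by apply; lra.
Qed.

(** The homothety with centre [p] and ratio [t] carries the room around [q] to room around the new
    point. *)
Lemma relpt_move S p q (t : R) : convex S -> relpt S q -> S p -> 0 < t ->
  t <= 1 -> relpt S (p + t *: (q - p)).
Proof.
move=> cS [Sq hq] Sp t0 t1; split; first by apply: cS => //; exact: ltW.
move=> v /hq[d d0 Sd]; exists (t * d); first exact: mulr_gt0.
have := cS _ _ t Sp Sd (ltW t0) t1; congr S.
by apply/rowP => i; rewrite !mxE; ring.
Qed.

Lemma relpt_back S x y : convex S -> relpt S x -> S y ->
  exists2 d : R, 0 < d & S (x - d *: (y - x)).
Proof.
move=> cS [Sx hx] Sy.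
have [|d d0 Sd] := hx (x - y); first exact: dirsp_sub.
by exists d => //; rewrite -scalerN opprB.
Qed.

Lemma polyhedron_convex S : is_polyhedron S -> convex S.
Proof.
move=> [s ->] p q t /= Sp Sq t0 t1 ab abs.
have := Sp _ abs; have := Sq _ abs; rewrite dotvDr dotvZr dotvBr => hq hp.
have -> : dotv ab.1 p + t * (dotv ab.1 q - dotv ab.1 p) =
  (1 - t) * dotv ab.1 p + t * dotv ab.1 q by ring.
have -> : ab.2 = (1 - t) * ab.2 + t * ab.2 by ring.
by apply: lerD; rewrite ler_wpM2l // subr_ge0.
Qed.

(** If the form were smaller at [y], it would exceed its maximum just beyond [x] on the line from
    [y] through [x]. *)
Lemma relpt_face_eq S x w (c : R) : convex S -> relpt S x ->
  (forall y, S y -> dotv w y <= c) -> dotv w x = c ->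
  forall y, S y -> dotv w y = c.
Proof.
move=> cS rx wS wx y Sy; have [d d0 /wS] := relpt_back cS rx Sy.
rewrite dotvBr dotvZr dotvBr wx gerDl oppr_le0 pmulr_rge0 // subr_ge0.
by move=> h; apply/eqP; rewrite eq_le h wS.
Qed.

End Directions.

(** * Uniform constants over finite sets, and short rays in open sets *)

Lemma finite_uniform_lt (R : realType) (T : choiceType) (A : set T)
    (P : T -> R -> Prop) : finite_set A ->
  (forall a e e', 0 < e' -> e' <= e -> P a e -> P a e') ->
  (forall a, A a -> exists2 e, 0 < e & P a e) ->
  exists2 e, 0 < e & forall a, A a -> P a e.
Proof.
move=> /finite_seqP[s ->] mono; elim: s => [|a s IH] Ps; first by exists 1.
have [e1 e10 P1] := Ps a (mem_head _ _).
have [|e2 e20 P2] := IH; first by move=> b bs; apply: Ps; rewrite /= in_cons bs orbT.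
have e0 : 0 < Num.min e1 e2 by rewrite lt_min e10.
exists (Num.min e1 e2) => // b /=; rewrite in_cons => /predU1P[->|bs].
  by apply: mono P1 => //; rewrite ge_min lexx.
by apply: mono (P2 _ bs) => //; rewrite ge_min lexx orbT.
Qed.

(** Large constants are treated as inverses of small positive ones. *)
Lemma finite_uniform_gt (R : realType) (T : choiceType) (A : set T)
    (P : T -> R -> Prop) : finite_set A ->
  (forall a C C', C <= C' -> P a C -> P a C') ->
  (forall a, A a -> exists C, P a C) -> exists2 C, 0 <= C & forall a, A a -> P a C.
Proof.
move=> fA mono ex.
have [|a Aa|e e0 Pe] := finite_uniform_lt (P := fun a e => P a e^-1) fA.
- by move=> a e e' e'0 ee'; apply: mono; rewrite lef_pV2 // posrE (lt_le_trans e'0).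
- have [C PC] := ex a Aa; have C0 : 0 < 1 + `|C| by rewrite ltr_pwDl.
  exists (1 + `|C|)^-1; rewrite ?invr_gt0 // invrK.
  by apply: mono PC; rewrite (le_trans (ler_norm _)) // lerDr.
- by exists e^-1 => //; rewrite invr_ge0 ltW.
Qed.

Lemma open_ray (R : realType) (n : nat) (B : set 'rV[R]_n) (y v : 'rV[R]_n) :
  open B -> B y ->
  exists2 e : R, 0 < e & forall t, 0 <= t -> t <= e -> B (y + t *: v).
Proof.
move=> oB By; have cf : continuous (fun t : R => y + t *: v).
  by move=> t; apply: cvgD; [exact: cvg_cst | exact: scalel_continuous].
have /cf/nbhs_ballP[e /= e0 eB] : nbhs (y + (0 : R) *: v) B.
  by rewrite scale0r addr0; exact: open_nbhs_nbhs.
exists (e / 2); first by rewrite divr_gt0.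
move=> t t0 te; apply: eB; rewrite /ball /= sub0r normrN ger0_norm //.
by rewrite (le_lt_trans te) // ltr_pdivrMr // ltr_pMr // ltr1n.
Qed.

(** * Segments and faces in a complex; invariance of germs under subdivision *)

Section Complexes.
Variables (R : realType) (X : topologicalType) (n : nat).
Variable iota : X -> 'rV[R]_n.
Implicit Types (Pi : set (set X)) (sigma tau rho V : set X) (x y z : X).
Implicit Types (u v w p q : 'rV[R]_n).

Notation im sigma := (iota @` sigma).
Notation dir sigma := (dirsp (iota @` sigma)).

Lemma cx_inj Pi sigma x y : is_cx iota Pi -> Pi sigma -> sigma x -> sigma y ->
  iota x = iota y -> x = y.
Proof. by case=> _ _ h _ _ /h [_ [inj _] _]; exact: inj. Qed.

Lemma cx_convex Pi sigma : is_cx iota Pi -> Pi sigma -> convex (im sigma).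
Proof. by case=> _ _ h _ _ /h [_ _]; exact: polyhedron_convex. Qed.

Lemma cx_closed Pi sigma : is_cx iota Pi -> Pi sigma -> closed sigma.
Proof. by case=> _ _ h _ _ /h []. Qed.

(** As [iota] is a homeomorphism from [sigma] onto its image, membership in [V] is tested on an open
    set [B] of the vector space; convexity keeps the segment in [sigma]. *)
Lemma cx_ray Pi sigma V x v (d : R) : is_cx iota Pi -> Pi sigma -> open V ->
  V x -> sigma x -> 0 < d -> im sigma (iota x + d *: v) ->
  exists2 e : R, 0 < e & forall t, 0 <= t -> t <= e ->
    exists y, [/\ sigma y, V y & iota y = iota x + t *: v].
Proof.
move=> cx Ps oV Vx sx d0 sd; case: (cx) => _ _ /(_ _ Ps) [_ [_ [_ ho]] _] _ _.
have [B [oB hB]] := ho _ oV.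
have Bx : B (iota x).
  by have [] : (B `&` im sigma) (iota x) by rewrite -hB; exists x.
have [e e0 he] := open_ray v oB Bx.
exists (Num.min d e); first by rewrite lt_min d0.
move=> t t0; rewrite le_min => /andP[td te].
have sxt : im sigma (iota x + t *: v).
  apply: (convex_ray (a := 0) (b := d) (cx_convex cx Ps)) => //.
  by rewrite scale0r addr0; exists x.
have : (B `&` im sigma) (iota x + t *: v) by split => //; exact: he.
by rewrite -hB => -[y [Vy sy] iy]; exists y.
Qed.

(** A short step from a point of [tau] in [V] towards a relative interior point stays in [V] and is
    already relatively interior. This supplies the base points of all local computations. *)
Lemma cx_relpt Pi tau V : is_cx iota Pi -> Pi tau -> open V ->
  tau `&` V !=set0 -> exists x, [/\ tau x, V x & relpt (im tau) (iota x)].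
Proof.
move=> cx Pt oV [p [tp Vp]]; have ct := cx_convex cx Pt.
have ne : im tau !=set0 by exists (iota p), p.
have [q rq] := relpt_exists ct ne.
have [||e e0 he] := cx_ray (v := q - iota p) (d := 1) cx Pt oV Vp tp.
- by [].
- by rewrite scale1r addrC subrK; case: rq.
have m0 : 0 < Num.min 1 e by rewrite lt_min e0 ltr01.
have [||y [ty Vy iy]] := he (Num.min 1 e); first exact: ltW.
  by rewrite ge_min lexx orbT.
exists y; split=> //; rewrite iy; apply: relpt_move => //.
by rewrite ge_min lexx.
Qed.

Lemma face_sub tau sigma : face iota tau sigma -> tau `<=` sigma.
Proof. by move=> [w [c [_ ->]]] x []. Qed.

Lemma cx_sub_face Pi tau sigma : is_cx iota Pi -> Pi tau -> Pi sigma ->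
  tau `<=` sigma -> face iota tau sigma.
Proof.
move=> [_ _ _ _ h] Pt Ps ts; have [_] := h _ _ Pt Ps.
by rewrite (setIidl ts).
Qed.

Lemma face_line tau sigma a b y p v (r s t : R) : face iota tau sigma ->
  tau a -> tau b -> sigma y -> iota a = p + r *: v -> iota b = p + s *: v ->
  r < s -> iota y = p + t *: v -> tau y.
Proof.
move=> [w [c [_ ->]]] [_ wa] [_ wb] sy ea eb rs ey; split=> //.
rewrite ea dotvDr dotvZr in wa; rewrite eb dotvDr dotvZr in wb.
have : (s - r) * dotv w v = 0 by rewrite mulrBl; lra.
move=> /eqP; rewrite mulf_eq0 subr_eq0 gt_eqF //= => /eqP wv.
by rewrite ey dotvDr dotvZr wv mulr0 addr0; rewrite wv mulr0 addr0 in wa.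
Qed.

Lemma face_dir tau sigma x y : face iota tau sigma -> tau x -> sigma y ->
  iota y - iota x \in dir tau -> tau y.
Proof.
move=> [w [c [ws e]]]; rewrite [in tau x]e [in tau y]e => -[sx wx] sy h.
split=> //; apply/eqP; rewrite -subr_eq0 -wx -dotvBr; apply/eqP.
apply: (dotv_dirsp0 _ h) => p q [p' + <-] [q' + <-].
by rewrite e => -[_ ->] [_ ->].
Qed.

Lemma face_relpt tau sigma x : face iota tau sigma -> convex (im sigma) ->
  tau x -> relpt (im sigma) (iota x) -> sigma `<=` tau.
Proof.
move=> [w [c [ws ->]]] cs [sx wx] rx y sy; split=> //.
apply: (relpt_face_eq cs rx _ wx); last by exists y.
by move=> _ [z sz <-]; exact: ws.
Qed.

Lemma subset_dir_dim tau sigma : tau `<=` sigma ->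
  (\dim (dir tau) <= \dim (dir sigma))%N.
Proof.
by move=> ts; apply: dimvS; apply: dirsp_mono; exact: image_subset.
Qed.

Lemma face_dim_eq tau sigma x : face iota tau sigma -> tau x ->
  (\dim (dir sigma) <= \dim (dir tau))%N -> tau = sigma.
Proof.
move=> fts tx d; apply/seteqP; split; first exact: face_sub.
have ts : (dir tau <= dir sigma)%VS.
  by apply: dirsp_mono; apply: image_subset; exact: face_sub.
have /eqP e : dir tau == dir sigma by rewrite eqEdim ts.
move=> y sy; apply: (face_dir fts tx sy); rewrite e.
by apply: dirsp_sub; [exists y|exists x => //; exact: (face_sub fts)].
Qed.

(** A curve in [X] that starts at [x] as a segment with velocity [v] inside one polyhedron; beyond
    time [e] nothing is required of it. *)
Definition germ Pi x v (gam : R -> X) := gam 0 = x /\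
  exists sigma (e : R), [/\ Pi sigma, 0 < e &
    forall t, 0 <= t -> t <= e -> sigma (gam t) /\ iota (gam t) = iota x + t *: v].

Lemma germ_exists Pi sigma x v (d : R) : is_cx iota Pi -> Pi sigma -> sigma x ->
  0 < d -> im sigma (iota x + d *: v) ->
  exists gam, germ Pi x v gam /\ forall t, 0 <= t -> t <= d ->
    sigma (gam t) /\ iota (gam t) = iota x + t *: v.
Proof.
move=> cx Ps sx d0 sd.
have ex t : exists y, 0 <= t -> t <= d -> sigma y /\ iota y = iota x + t *: v.
  have [/andP[t0 td]|h] := boolP (0 <= t <= d); last first.
    by exists x => t0 td; rewrite t0 td in h.
  have : im sigma (iota x + t *: v).
    apply: (convex_ray (a := 0) (b := d) (cx_convex cx Ps)) => //.
    by rewrite scale0r addr0; exists x.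
  by move=> [y sy iy]; exists y.
have [gam hg] := choice ex; exists gam; split=> //; split; last by exists sigma, d.
have [s0 i0] := hg 0 (lexx _) (ltW d0).
by apply: (cx_inj cx Ps) => //; rewrite i0 scale0r addr0.
Qed.

Lemma germ_open Pi x v gam V : is_cx iota Pi -> germ Pi x v gam -> open V ->
  V x -> exists2 e : R, 0 < e & forall t, 0 <= t -> t <= e -> V (gam t).
Proof.
move=> cx [g0 [sigma [d [Ps d0 h]]]] oV Vx.
have sx : sigma x by rewrite -g0; apply: (h 0 (lexx _) (ltW d0)).1.
have [sd id] := h d (ltW d0) (lexx _).
have [|e e0 he] := cx_ray (v := v) cx Ps oV Vx sx d0; first by exists (gam d).
exists (Num.min d e); first by rewrite lt_min d0.
move=> t t0; rewrite le_min => /andP[td te].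
have [y [sy Vy iy]] := he t t0 te; have [sg ig] := h t t0 td.
by rewrite (cx_inj cx Ps sg sy) // ig iy.
Qed.

(** By local finiteness some cell [s] of the finer complex is met at arbitrarily small times;
    convexity of [s] fills the gaps between these times, and closedness adds the starting point. *)
Lemma germ_sub Pi' Pi x v gam : subdivides iota Pi' Pi -> germ Pi x v gam ->
  germ Pi' x v gam.
Proof.
move=> [cx' cx sub] gg; have [g0 [sigma [d [Ps d0 hd]]]] := gg.
have [cov lf _ _ _] := cx'; have [N [nN fN]] := lf x.
move: nN; rewrite nbhsE => -[V [oV Vx] VN].
have [e1 e10 h1] := germ_open cx gg oV Vx.
pose good s := forall e, 0 < e -> exists t, [/\ 0 < t, t <= e & s (gam t)].
(* Otherwise each of the finitely many cells near [x] is avoided for a short time, and a common such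
   time leaves a point of the curve uncovered. *)
have [s [Ps' gs]] : exists s, Pi' s /\ good s.
  apply: contrapT => no; have [||e e0 he] := finite_uniform_lt
    (P := fun s e => forall t, 0 < t -> t <= e -> ~ s (gam t)) fN.
  - move=> s e e' e'0 ee' he t t0 te'; apply: he => //; exact: le_trans ee'.
  - move=> s [Ps' _]; have /existsNP[e /not_implyP[e0 ne]] : ~ good s.
      by move=> gs; apply: no; exists s.
    by exists e => // t t0 te st; apply: ne; exists t.
  have m0 : 0 < Num.min e e1 by rewrite lt_min e0.
  have [s [Ps' sg]] := cov (gam (Num.min e e1)).
  apply: (he s _ (Num.min e e1)) => //; last by rewrite ge_min lexx.
  split=> //; exists (gam (Num.min e e1)); split=> //; apply: VN; apply: h1.
    exact: ltW.
  by rewrite ge_min lexx orbT.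
have [t0 [t00 t0d st0]] := gs d d0.
have hs t : 0 < t -> t <= t0 -> s (gam t).
  move=> tp tt0; have [r [r0 rt sr]] := gs t tp.
  have [sg ig] := hd t (ltW tp) (le_trans tt0 t0d).
  have [sr' ir] := hd r (ltW r0) (le_trans rt (le_trans tt0 t0d)).
  have [st0' it0] := hd t0 (ltW t00) t0d.
  have [rt0|] := ltrP r t0; last first.
    by move=> h; have -> : t = t0 by apply/eqP; rewrite eq_le tt0 (le_trans h).
  have [y sy iy] : im s (iota x + t *: v).
    apply: (convex_ray (a := r) (b := t0) (cx_convex cx' Ps')) => //.
      by exists (gam r).
    by exists (gam t0).
  (* The point [y] of [s] has the same image as [gam t] but might differ from it. The face common to
     [sigma] and [sigma2] contains [gam r] and [gam t0], hence also [y]; so [y] lies in [sigma],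
     where [iota] is injective. *)
  have [sigma2 [Ps2 s2]] := sub _ Ps'.
  have [_ _ _ _ hi] := cx; have [f2 _] := hi _ _ Ps2 Ps.
  have [_ sy'] : (sigma2 `&` sigma) y.
    by apply: (face_line f2 _ _ _ ir it0 rt0 iy); [split=> //; exact: s2..|exact: s2].
  by rewrite (cx_inj cx Ps sg sy') // ig iy.
have sx : s x.
  apply: contrapT => nsx; have oC : open (~` s).
    by apply: closed_openC; exact: cx_closed cx' Ps'.
  have [e e0 he] := germ_open cx gg oC nsx.
  have [t [tp te st]] := gs e e0; exact: (he t (ltW tp) te st).
split=> //; exists s, t0; split=> // t t0' tt0.
split; last by apply: (hd _ t0' (le_trans tt0 t0d)).2.
have [t00'|] := ltrP 0 t; first exact: hs.
by move=> tle; have -> : t = 0; [apply/eqP; rewrite eq_le t0' tle | rewrite g0].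
Qed.

Lemma germ_subE Pi' Pi x v gam : subdivides iota Pi' Pi ->
  germ Pi' x v gam <-> germ Pi x v gam.
Proof.
move=> sd; split; last exact: germ_sub sd.
move=> [g0 [s [e [Ps e0 h]]]]; split=> //; have [_ _ sub] := sd.
have [sigma [Psi ss]] := sub _ Ps; exists sigma, e; split=> // t t0 te.
by have [sg ig] := h t t0 te; split=> //; exact: ss.
Qed.

(** Induction along the chain of subdivisions that generates the equivalence; this is how a
    condition on germs passes to an arbitrary equivalent complex. *)
Lemma same_space_germ Pi Pi1 x v gam : same_space iota Pi Pi1 ->
  germ Pi1 x v gam <-> germ Pi x v gam.
Proof.
elim=> [A B sd|A|A B _ ->|A B C _ hAB _ hBC] //; first exact: germ_subE.
by rewrite hBC.
Qed.

Lemma same_space_cx Pi Pi1 : same_space iota Pi Pi1 ->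
  is_cx iota Pi <-> is_cx iota Pi1.
Proof.
elim=> [A B []|A|A B _ ->|A B C _ hAB _ hBC] //.
by rewrite hAB.
Qed.

End Complexes.

(** * Cones and orthonormal frames in a plane *)

Lemma seq_argmin (R : realType) (T : eqType) (f : T -> R) (s : seq T) :
  s != [::] -> exists2 a, a \in s & forall b, b \in s -> f a <= f b.
Proof.
elim: s => // a [|b s] IH _.
  by exists a; rewrite ?mem_head // => b; rewrite inE => /eqP ->.
have [//|m ms hm] := IH; have [am|ma] := lerP (f a) (f m).
  exists a; rewrite ?mem_head // => d; rewrite in_cons => /predU1P[->//|/hm].
  exact: le_trans.
exists m; first by rewrite in_cons ms orbT.
by move=> d; rewrite in_cons => /predU1P[->|/hm//]; exact: ltW.
Qed.

Section Vectors.
Variables (R : realType) (n : nat).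
Implicit Types (u v w p q e : 'rV[R]_n) (L M : {vspace 'rV[R]_n}).

(* In the polar cone of J, the ray from p in the direction -q leaves the cone
   through a wall that q does not lie on. *)
Lemma extreme_ray (J : seq 'rV[R]_n) p q :
  (forall a, a \in J -> dotv a p <= 0) -> (forall a, a \in J -> dotv a q <= 0) ->
  (exists2 a, a \in J & dotv a q < 0) ->
  exists t a, [/\ 0 <= t, a \in J, dotv a (p - t *: q) = 0, dotv a q < 0 &
    forall b, b \in J -> dotv b (p - t *: q) <= 0].
Proof.
move=> Jp Jq [a0 a0J a0q].
have [|a] := seq_argmin (fun a => dotv a p / dotv a q)
    (s := [seq a <- J | dotv a q < 0]).
  by rewrite -has_filter; apply/hasP; exists a0.
rewrite mem_filter => /andP[aq aJ] amin.
exists (dotv a p / dotv a q), a; split=> //.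
- by rewrite -mulrNN -invrN divr_ge0 // oppr_ge0 ?Jp // ltW.
- by rewrite dotvBr dotvZr divfK ?lt_eqF // subrr.
- move=> b bJ; rewrite dotvBr dotvZr; have [bq|bq] := ltrP (dotv b q) 0; last first.
    have -> : dotv b q = 0 by apply/eqP; rewrite eq_le bq Jq.
    by rewrite mulr0 subr0 Jp.
  have := amin b; rewrite mem_filter bq bJ => /(_ isT).
  by rewrite -(ler_nM2r bq) divfK ?lt_eqF // subr_le0.
Qed.

(** By dimension [M] is the orthogonal sum of [L] and the line of [e], so removing the component
    along [e] lands in [L]. *)
Lemma dir_decomp L M e v : (L <= M)%VS -> \dim M = (\dim L).+1 -> e \in M ->
  dotv e e = 1 -> (forall u, u \in L -> dotv e u = 0) -> v \in M ->
  v - dotv e v *: e \in L.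
Proof.
move=> LM dM eM ee eL vM.
have eNL : e \notin L by apply/negP => /eL; rewrite ee; apply/eqP; exact: oner_neq0.
have sM : (L + <[e]> <= M)%VS by rewrite subv_add LM -memvE.
have dL : (\dim L < \dim (L + <[e]>))%N.
  rewrite ltn_neqAle dimvS ?addvSl // andbT (dimv_leqif_sup (addvSl _ _)).
  by rewrite subv_add subvv /= -memvE.
have /eqP eM' : (L + <[e]>)%VS == M by rewrite eqEdim sM dM.
move: vM; rewrite -eM' => /memv_addP[u uL [_ /vlineP[k ->] ->]].
by rewrite dotvDr eL // add0r dotvZr ee mulr1 addrK.
Qed.

(** Removing the components along [f] and then [e] leaves a vector [z] of [L] that is also
    orthogonal to [L], hence 0. *)
Lemma orth_basis2 L M N e f v : (L <= M)%VS -> (M <= N)%VS ->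
  \dim M = (\dim L).+1 -> \dim N = (\dim M).+1 ->
  e \in M -> f \in N -> dotv e e = 1 -> dotv f f = 1 ->
  (forall u, u \in L -> dotv e u = 0) -> (forall u, u \in M -> dotv f u = 0) ->
  v \in N -> (forall u, u \in L -> dotv v u = 0) ->
  v = dotv e v *: e + dotv f v *: f.
Proof.
move=> LM MN dM dN eM fN ee ff eL fM vN vL.
have h1 := dir_decomp MN dN fN ff fM vN.
have h2 := dir_decomp LM dM eM ee eL h1.
set z := (X in X \in L) in h2.
have vz : v = dotv e v *: e + dotv f v *: f + z.
  rewrite /z dotvBr dotvZr (dotvC e f) (fM _ eM) mulr0 subr0.
  by apply/rowP => i; rewrite !mxE; ring.
have : dotv z z = 0.
  rewrite {1}/z !dotvBl !dotvZl (eL _ h2) (fM _ (subvP LM _ h2)) (vL _ h2).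
  by rewrite !mulr0 !subr0.
by move/eqP; rewrite dotv_eq0 => /eqP z0; rewrite {1}vz z0 addr0.
Qed.

(* For unit vectors e2, n2 of a Euclidean plane with orthonormal basis e1, n1,
   the signs force e2 = c e1 + s n1 and n2 = s e1 - c n1. *)
Lemma plane_flip w (e1 e2 n1 n2 : 'rV[R]_n) :
  dotv e1 e1 = 1 -> dotv e2 e2 = 1 -> dotv n1 n1 = 1 -> dotv n2 n2 = 1 ->
  dotv e1 n1 = 0 -> dotv e2 n2 = 0 ->
  e2 = dotv e1 e2 *: e1 + dotv n1 e2 *: n1 ->
  n2 = dotv e1 n2 *: e1 + dotv n1 n2 *: n1 ->
  0 < dotv n1 e2 -> 0 <= dotv e1 n2 ->
  dotv w n1 *: e1 + dotv w n2 *: e2 = dotv w e1 *: n1 + dotv w e2 *: n2.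
Proof.
set c := dotv e1 e2; set s := dotv n1 e2; set a := dotv e1 n2; set b := dotv n1 n2.
move=> e11 e22 n11 n22 e1n1 e2n2 E N s0 a0.
have n1e1 : dotv n1 e1 = 0 by rewrite dotvC.
have cs : c * c + s * s = 1.
  rewrite -e22 [in RHS]E !dotvDl !dotvDr !dotvZl !dotvZr e11 n11 e1n1 n1e1; ring.
have ab : a * a + b * b = 1.
  rewrite -n22 [in RHS]N !dotvDl !dotvDr !dotvZl !dotvZr e11 n11 e1n1 n1e1; ring.
have cab : c * a + s * b = 0.
  rewrite -e2n2 [in RHS]E [in RHS]N !dotvDl !dotvDr !dotvZl !dotvZr e11 n11 e1n1 n1e1; ring.
clearbody c s a b; have : a * a = s * s.
  have -> : a * a = (c * a) * (c * a) + (s * a) * (s * a).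
    by rewrite -[LHS]mulr1 -cs; ring.
  have -> : c * a = - (s * b) by apply/eqP; rewrite -addr_eq0 cab.
  by rewrite -[RHS]mulr1 -ab; ring.
move=> /eqP; rewrite -!expr2 eqrXn2 ?(ltW s0) // => /eqP as_.
have bc : b = - c.
  apply: (mulfI (lt0r_neq0 s0)); apply/eqP; rewrite -subr_eq0 -cab as_; apply/eqP; ring.
rewrite {}N {}E !dotvDr !dotvZr as_ bc.
have cc : c * c = 1 - s * s by rewrite -cs addrK.
set f := dotv w e1; set g := dotv w n1.
have h1 : g + (s * f + - c * g) * c = (c * f + s * g) * s.
  have -> : (s * f + - c * g) * c = s * c * f - (c * c) * g by ring.
  by rewrite cc; ring.
have h2 : f + (c * f + s * g) * - c = (s * f + - c * g) * s.
  have -> : (c * f + s * g) * - c = - (c * c) * f - s * c * g by ring.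
  by rewrite cc; ring.
apply/rowP => i; rewrite !mxE.
transitivity ((g + (s * f + - c * g) * c) * e1 0 i + ((s * f + - c * g) * s) * n1 0 i).
  by ring.
by rewrite h1 -h2; ring.
Qed.

End Vectors.

(** * Unit normals of facets and linear parts of piecewise affine functions *)

Section Normals.
Variables (R : realType) (X : topologicalType) (n : nat).
Variable iota : X -> 'rV[R]_n.
Implicit Types (Pi : set (set X)) (sigma tau rho V : set X) (x y z : X).
Implicit Types (u v w p q : 'rV[R]_n).

Notation im sigma := (iota @` sigma).
Notation dir sigma := (dirsp (iota @` sigma)).
Notation pd sigma := (\dim (dirsp (iota @` sigma))).

Lemma restrE Pi V k sigma : restr iota Pi V k sigma <->
  [/\ Pi sigma, sigma `&` V !=set0 & pd sigma = k].
Proof.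
split=> [[Ps [sV [_ /has_dimE d]]]|[Ps sV d]]; first by [].
by split=> //; split=> //; split; [have [x [sx _]] := sV; exists x | apply/has_dimE].
Qed.

(** The normal is the supporting form of [tau], projected to the directions of [sigma], negated and
    normalised. The projection is nonzero: otherwise the form would be constant on [sigma] and [tau]
    would be all of [sigma]. *)
Lemma normal_exists tau sigma x : face iota tau sigma -> tau x ->
  (pd tau < pd sigma)%N -> exists v, normal_prop iota sigma tau v.
Proof.
move=> fts tx dlt; have [w [c [ws e]]] := fts.
have [p pin hp] := orth_proj (dir sigma) w.
have wtau y : tau y -> dotv w (iota y) = c by rewrite e => -[].
have ts := face_sub fts.
have p0 : p != 0.
  apply: contraTneq dlt => p0; rewrite -leqNgt; apply: subset_dir_dim => y sy.
  have /hp : iota y - iota x \in dir sigma.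
    by apply: dirsp_sub; [exists y|exists x => //; exact: ts].
  rewrite p0 dotv0l dotvBr (wtau x tx) => /eqP; rewrite subr_eq0 => /eqP wy.
  by rewrite e.
have [k k0 kk] : exists2 k : R, 0 < k & k * (k * dotv p p) = 1.
  have pp := dotv_gt0 p0; have sp : 0 < Num.sqrt (dotv p p) by rewrite sqrtr_gt0.
  exists (Num.sqrt (dotv p p))^-1; first by rewrite invr_gt0.
  have {3}-> : dotv p p = Num.sqrt (dotv p p) ^+ 2 by rewrite sqr_sqrtr // ltW.
  by field; rewrite gt_eqF.
have hpw y z : sigma y -> sigma z -> dotv p (iota y - iota z) =
    dotv w (iota y) - dotv w (iota z).
  by move=> sy sz; rewrite -hp ?dotvBr //; apply: dirsp_sub; [exists y|exists z].
exists (- k *: p); split.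
- by rewrite dotvZl dotvZr !mulNr mulrN opprK.
- by apply/in_dirE; rewrite memvZ.
- move=> u [_ [_ [[y ty <-] [[z tz <-] ->]]]].
  by rewrite dotvZl hpw ?wtau ?subrr ?mulr0 //; exact: ts.
- move=> y z sy tz; rewrite dotvZl hpw //; last exact: ts.
  by rewrite (wtau z tz) mulNr oppr_ge0 pmulr_rle0 // subr_le0 ws.
Qed.

Lemma nvecP tau sigma x (e := nvec iota sigma tau) : face iota tau sigma ->
  tau x -> (pd tau < pd sigma)%N ->
  [/\ dotv e e = 1, e \in dir sigma, forall u, u \in dir tau -> dotv e u = 0 &
    forall x y, sigma x -> tau y -> 0 <= dotv e (iota x - iota y)].
Proof.
move=> fts tx dlt; rewrite /e /nvec.
have [] := xgetPex 0 (normal_exists fts tx dlt); set v := xget _ _.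
move=> vv /in_dirE vs vt vp; split=> //; apply: dotv_dirsp0 => p q tp tq.
by apply/eqP; rewrite -subr_eq0 -dotvBr; apply/eqP; apply: vt; exists p, q.
Qed.

(** Some [y] in [sigma] is displaced from [x] by [u + a *: e] with [u] along [tau] and [a] positive;
    the room of [tau] at [x] in the direction [- u] serves to cancel [u]. *)
Lemma nvec_ray tau sigma x : face iota tau sigma -> convex (im sigma) -> tau x ->
  relpt (im tau) (iota x) -> pd sigma = (pd tau).+1 ->
  exists2 d : R, 0 < d & im sigma (iota x + d *: nvec iota sigma tau).
Proof.
move=> fts cs tx rx ds; have dlt : (pd tau < pd sigma)%N by rewrite ds.
have [] := nvecP fts tx dlt; set e := nvec _ _ _ => ee es et ep.
have ts := face_sub fts.
have dts : (dir tau <= dir sigma)%VS by apply: dirsp_mono; exact: image_subset.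
have [y [sy ny]] : exists y, sigma y /\ iota y - iota x \notin dir tau.
  apply: contrapT => no; move: dlt; rewrite ltnNge => /negP; apply; apply: dimvS.
  have h z : sigma z -> iota z - iota x \in dir tau.
    by move=> sz; apply/negPn/negP => nz; apply: no; exists z.
  apply: dirsp_min => _ _ [z sz <-] [z' sz' <-].
  have -> : iota z - iota z' = iota z - iota x - (iota z' - iota x).
    by rewrite opprB addrA subrK.
  by rewrite rpredB // h.
have yxs : iota y - iota x \in dir sigma.
  by apply: dirsp_sub; [exists y|exists x => //; exact: ts].
have ut := dir_decomp dts ds es ee et yxs.
set a := dotv e _ in ut; set u := (X in X \in _) in ut.
have a0 : 0 < a.
  rewrite lt_def ep // andbT; apply: contraNneq ny => a0.
  by move: ut; rewrite /u a0 scale0r subr0.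
have [|d d0 td] := rx.2 (- u); first by rewrite memvN.
have sd : im sigma (iota x + d *: - u) by have [z tz <-] := td; exists z => //; exact: ts.
have d1 : 0 < 1 + d by rewrite addr_gt0.
(* With weight [d / (1 + d)] on [y] and the remaining weight on the point displaced by [- d *: u],
   the contributions of [u] cancel. *)
exists (d / (1 + d) * a); first by rewrite mulr_gt0 // divr_gt0.
have isy : im sigma (iota y) by exists y.
have := cs _ _ (d / (1 + d)) sd isy.
have -> : iota x + d / (1 + d) * a *: e =
    iota x + d *: - u + d / (1 + d) *: (iota y - (iota x + d *: - u)).
  have -> : iota y = iota x + u + a *: e by rewrite /u addrA !subrK addrC subrK.
  by apply/rowP => i; rewrite !mxE; field; rewrite gt_eqF.
by apply; [rewrite divr_ge0 // ltW | rewrite ler_pdivrMr // mul1r lerDr].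
Qed.

Lemma lin_partP Pi V f sigma : is_pa iota Pi V f -> Pi sigma ->
  sigma `&` V !=set0 -> forall x, sigma x -> V x ->
  f x = dotv (lin_part iota V f sigma) (iota x).
Proof. by move=> pf Ps sV; exact: (xgetPex 0 (pf _ Ps sV)). Qed.

(** [lin_part] is chosen and may be ambiguous, but along directions of [rho] both forms compute the
    increments of [f] at a relative interior point of [rho]. *)
Lemma lin_part_face Pi V f rho sigma v : is_cx iota Pi -> open V ->
  is_pa iota Pi V f -> Pi rho -> Pi sigma -> rho `<=` sigma ->
  rho `&` V !=set0 -> v \in dir rho ->
  dotv (lin_part iota V f sigma) v = dotv (lin_part iota V f rho) v.
Proof.
move=> cx oV pf Pr Ps rs rV vr.
have sV : sigma `&` V !=set0 by have [y [ry Vy]] := rV; exists y; split=> //; exact: rs.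
have [x [rx Vx rp]] := cx_relpt cx Pr oV rV.
have [d d0 rd] := rp.2 v vr.
have [e e0 he] := cx_ray cx Pr oV Vx rx d0 rd.
have [y [ry Vy iy]] := he e (ltW e0) (lexx _).
have := lin_partP pf Pr rV ry Vy; rewrite (lin_partP pf Ps sV (rs _ ry) Vy).
have := lin_partP pf Pr rV rx Vx; rewrite (lin_partP pf Ps sV (rs _ rx) Vx).
rewrite iy !dotvDr => -> /addrI; rewrite !dotvZr => /mulfI; apply.
by rewrite gt_eqF.
Qed.

End Normals.

(** * Tangent cones of polyhedra and their extreme rays *)

Section Facets.
Variables (R : realType) (n : nat).
Implicit Types (u v w p q e : 'rV[R]_n) (L M E : {vspace 'rV[R]_n}).
Implicit Types (S : set 'rV[R]_n).

Lemma dim_add_line E v : v \notin E -> \dim (E + <[v]>) = (\dim E).+1.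
Proof.
move=> vE; apply/eqP; rewrite eqn_leq; apply/andP; split.
  apply: leq_trans (dimv_add_leqif E <[v]>) _.
  by rewrite dim_vline; case: (v != 0); rewrite ?addn1 ?addn0.
rewrite ltn_neqAle dimvS ?addvSl // andbT (dimv_leqif_sup (addvSl _ _)).
by rewrite subv_add subvv /= -memvE.
Qed.

Lemma dirsp_outside S x L : S x -> (\dim L < \dim (dirsp S))%N ->
  exists2 y, S y & y - x \notin L.
Proof.
move=> Sx; rewrite ltnNge => /negP dL; apply: contrapT => no; apply: dL.
have h y : S y -> y - x \in L.
  by move=> Sy; apply/negPn/negP => ny; apply: no; exists y.
apply: dimvS; apply: dirsp_min => p q Sp Sq.
have -> : p - q = p - x - (q - x) by rewrite opprB addrA subrK.
by rewrite rpredB // h.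
Qed.

(** [J] lists the constraints that are equalities at [x]; the others have slack, so only [J]
    restricts a short step. *)
Lemma polyhedron_tangent S x : is_polyhedron S -> S x ->
  exists J : seq 'rV[R]_n,
    (forall a, a \in J -> forall y, S y -> dotv a y <= dotv a x) /\
    forall v, (forall a, a \in J -> dotv a v <= 0) ->
      exists2 d : R, 0 < d & S (x + d *: v).
Proof.
move=> [s ->] /= Sx.
exists [seq ab.1 | ab <- [seq ab <- s | dotv ab.1 x == ab.2]]; split.
  move=> a /mapP[ab]; rewrite mem_filter => /andP[/eqP e abs] -> y Sy.
  by rewrite e; exact: Sy.
move=> v Jv; have [||| d d0 hd] := finite_uniform_lt (A := [set` s])
    (P := fun ab t => forall r, 0 < r -> r <= t -> dotv ab.1 (x + r *: v) <= ab.2).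
- by apply/finite_seqP; exists s.
- by move=> ab t t' t'0 tt' h r r0 rt; apply: h => //; exact: le_trans tt'.
- move=> ab /= abs; have := Sx _ abs; rewrite le_eqVlt => /predU1P[e|lt].
    exists 1 => // r r0 _; rewrite dotvDr dotvZr e gerDl pmulr_rle0 //; apply: Jv.
    by apply/mapP; exists ab => //; rewrite mem_filter e eqxx.
  have k0 : 0 < 1 + `|dotv ab.1 v| by rewrite ltr_pwDl.
  exists ((ab.2 - dotv ab.1 x) / (1 + `|dotv ab.1 v|)).
    by rewrite divr_gt0 // subr_gt0.
  move=> r r0; rewrite ler_pdivlMr // => h.
  rewrite dotvDr dotvZr -lerBrDl; apply: le_trans h.
  rewrite ler_pM2l // (le_trans (ler_norm _)) // lerDr.
  exact: ler01.
- by exists d => // ab abs; apply: hd.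
Qed.

(** Modulo the lineality space [E] the cone of [J] is pointed and lies in a plane. Leaving it from
    [p] away from [q], and from [q] away from [p], yields its two extreme rays. *)
Lemma two_rays E M (J : seq 'rV[R]_n) p q :
  (E <= M)%VS -> \dim M = (\dim E).+2 ->
  (forall a, a \in J -> forall u, u \in E -> dotv a u = 0) ->
  (forall v, v \in M -> (forall a, a \in J -> dotv a v = 0) -> v \in E) ->
  p \in M -> q \in M -> p \notin E -> q \notin (E + <[p]>)%VS ->
  (forall a, a \in J -> dotv a p <= 0) -> (forall a, a \in J -> dotv a q <= 0) ->
  exists r1 r2 a1 a2,
    [/\ [/\ a1 \in J, dotv a1 r1 = 0 & dotv a1 r2 < 0],
        [/\ a2 \in J, dotv a2 r2 = 0 & dotv a2 r1 < 0],
        (forall a, a \in J -> dotv a r1 <= 0),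
        (forall a, a \in J -> dotv a r2 <= 0) &
        forall v, v \in M -> exists u a b,
          u \in E /\ v = u + a *: r1 + b *: r2].
Proof.
move=> EM dM JE JM pM qM pE qE Jp Jq.
have strict v : v \in M -> v \notin E -> (forall a, a \in J -> dotv a v <= 0) ->
    exists2 a, a \in J & dotv a v < 0.
  move=> vM vE Jv; apply: contrapT => no; move/negP: vE; apply; apply: JM => // a aJ.
  apply/eqP; rewrite eq_le Jv //= leNgt; apply/negP => av.
  by apply: no; exists a.
have qE' : q \notin E by apply: contra qE; apply/subvP; exact: addvSl.
have [t1 [a1 [t10 a1J a1r a1q Jr1]]] := extreme_ray Jp Jq (strict _ qM qE' Jq).
have [t2 [a2 [t20 a2J a2r a2p Jr2]]] := extreme_ray Jq Jp (strict _ pM pE Jp).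
set r1 := p - _ in a1r Jr1; set r2 := q - _ in a2r Jr2.
have spanM v : v \in M -> exists u a b, u \in E /\ v = u + a *: p + b *: q.
  have /eqP <- : (E + <[p]> + <[q]>)%VS == M.
    by rewrite eqEdim !subv_add EM -!memvE pM qM !dim_add_line // dM leqnn.
  move=> /memv_addP[_ /memv_addP[u uE [_ /vlineP[a ->] ->]] [_ /vlineP[b ->] ->]].
  by exists u, a, b.
(* If [t1 * t2] were 1, the two rays would be opposite, so every form of [J] would vanish on [r1];
   then [r1] lies in [E] and [q] depends on [p] modulo [E]. *)
have t12 : 1 - t1 * t2 != 0.
  apply/eqP => /eqP; rewrite subr_eq0 => /eqP t12.
  have r21 : r2 = - t2 *: r1.
    apply/rowP => i; rewrite !mxE.
    transitivity (t1 * t2 * q 0 i - t2 * p 0 i); last by ring.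
    by rewrite -t12 mul1r.
  have r1E : r1 \in E.
    apply: JM; first by rewrite memvB ?memvZ.
    move=> a aJ; apply/eqP; rewrite eq_le Jr1 //=.
    have := Jr2 _ aJ; rewrite r21 dotvZr mulNr oppr_le0 pmulr_rge0 //.
    rewrite lt_def t20 andbT; apply/eqP => t0.
    by move/eqP: t12; rewrite t0 mulr0 oner_eq0.
  case/negP: qE; have t1n : t1 != 0.
    by apply/eqP => t0; move/eqP: t12; rewrite t0 mul0r oner_eq0.
  have -> : q = - t1^-1 *: r1 + t1^-1 *: p.
    by rewrite /r1; apply/rowP => i; rewrite !mxE; field.
  by rewrite memv_add ?memvZ ?memv_line.
exists r1, r2, a1, a2; split=> //.
- split=> //; rewrite lt_def Jr2 // andbT eq_sym; apply/eqP => a1r2.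
  move: a1q; apply/negP; rewrite -leNgt.
  have -> : q = (1 - t1 * t2)^-1 *: (r2 + t2 *: r1).
    by rewrite /r1 /r2; apply/rowP => i; rewrite !mxE; field.
  by rewrite dotvZr dotvDr dotvZr a1r a1r2 mulr0 addr0 mulr0.
- split=> //; rewrite lt_def Jr1 // andbT eq_sym; apply/eqP => a2r1.
  move: a2p; apply/negP; rewrite -leNgt.
  have -> : p = (1 - t1 * t2)^-1 *: (r1 + t1 *: r2).
    by rewrite /r1 /r2; apply/rowP => i; rewrite !mxE; field.
  by rewrite dotvZr dotvDr dotvZr a2r a2r1 mulr0 addr0 mulr0.
- move=> v /spanM[u [a [b [uE ->]]]].
  (* Coefficients from solving [r1 = p - t1 *: q], [r2 = q - t2 *: p] for [p] and [q]. *)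
  exists u, ((a + b * t2) / (1 - t1 * t2)), ((b + a * t1) / (1 - t1 * t2)).
  by split=> //; rewrite /r1 /r2; apply/rowP => i; rewrite !mxE; field.
Qed.

End Facets.

(** * Faces of codimension two *)

Section Diamond.
Variables (R : realType) (X : topologicalType) (n : nat).
Variable iota : X -> 'rV[R]_n.
Implicit Types (Pi : set (set X)) (sigma tau rho V : set X) (x y z : X).
Implicit Types (u v w p q : 'rV[R]_n).

Notation im sigma := (iota @` sigma).
Notation dir sigma := (dirsp (iota @` sigma)).
Notation pd sigma := (\dim (dirsp (iota @` sigma))).

(** Modulo the directions of [tau], the tangent cone of [sigma] at [x] is a plane cone with extreme
    rays [r1], [r2], and the walls through these rays are the two intermediate faces. *)
Lemma diamond Pi sigma tau x : is_cx iota Pi -> Pi sigma -> Pi tau ->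
  tau `<=` sigma -> tau x -> relpt (im tau) (iota x) ->
  pd sigma = (pd tau).+2 ->
  exists rho1 rho2, rho1 <> rho2 /\ forall rho,
    [/\ Pi rho, tau `<=` rho, rho `<=` sigma & pd rho = (pd tau).+1] <->
    (rho = rho1 \/ rho = rho2).
Proof.
move=> cx Ps Pt ts tx rx ds; have sx := ts _ tx.
have isx : im sigma (iota x) by exists x.
have its : im tau `<=` im sigma by exact: image_subset.
have tsd := dirsp_mono its.
have poly : is_polyhedron (im sigma) by case: cx => _ _ /(_ _ Ps) [].
have [J [Jle Jray]] := polyhedron_tangent poly isx.
have Jtau a : a \in J -> forall y, tau y -> dotv a (iota y) = dotv a (iota x).
  move=> aJ y ty; apply: (relpt_face_eq (cx_convex cx Pt) rx) => //.
  by move=> z /its; exact: Jle.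
have JE a : a \in J -> forall u, u \in dir tau -> dotv a u = 0.
  move=> aJ; apply: dotv_dirsp0 => _ _ [y ty <-] [z tz <-].
  by rewrite !Jtau.
have Jv y a : a \in J -> sigma y -> dotv a (iota y - iota x) <= 0.
  by move=> aJ sy; rewrite dotvBr subr_le0; apply: Jle => //; exists y.
have fts := cx_sub_face cx Pt Ps ts.
(* Both [v] and [- v] are feasible, so the form supporting [tau] vanishes on [v], and a short step
   along [v] stays in [tau]. *)
have JM v : v \in dir sigma -> (forall a, a \in J -> dotv a v = 0) -> v \in dir tau.
  move=> vs v0; have [|d d0 [y sy iy]] := Jray v; first by move=> a /v0 ->.
  have [|d' d'0 [z sz iz]] := Jray (- v).
    by move=> a /v0 av; rewrite dotvNr av oppr0.
  have [w [c [ws e]]] := fts.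
  have [_ wx] : sigma x /\ dotv w (iota x) = c by move: tx; rewrite e.
  have := ws _ sz; rewrite iz scalerN dotvBr dotvZr wx gerBl pmulr_rge0 // => wv1.
  have := ws _ sy; rewrite iy dotvDr dotvZr wx gerDl pmulr_rle0 // => wv2.
  have wv : dotv w v = 0 by apply/eqP; rewrite eq_le wv1 wv2.
  have ty : tau y by rewrite e; split=> //; rewrite iy dotvDr dotvZr wx wv mulr0 addr0.
  have : iota y - iota x \in dir tau by apply: dirsp_sub; [exists y|exists x].
  by rewrite iy addrC addKr rpredZeq gt_eqF.
have [_ [y1 sy1 <-] pE] : exists2 y, im sigma y & y - iota x \notin dir tau.
  by apply: dirsp_outside => //; rewrite ds ltnS leqnSn.
have [_ [y2 sy2 <-] qE] : exists2 y, im sigma y &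
    y - iota x \notin (dir tau + <[iota y1 - iota x]>)%VS.
  by apply: dirsp_outside => //; rewrite dim_add_line // ds.
have dirx y : sigma y -> iota y - iota x \in dir sigma.
  by move=> sy; apply: dirsp_sub => //; exists y.
have [r1 [r2 [a1 [a2 [[a1J a1r1 a1r2] [a2J a2r2 a2r1] Jr1 Jr2 spanM]]]]] :=
  two_rays tsd ds JE JM (dirx _ sy1) (dirx _ sy2) pE qE
    (fun a aJ => Jv y1 a aJ sy1) (fun a aJ => Jv y2 a aJ sy2).
pose wall a := [set y | sigma y /\ dotv a (iota y) = dotv a (iota x)].
have wallP a : a \in J -> Pi (wall a).
  move=> aJ; have [_ _ _ hf _] := cx; apply: (hf sigma) => //.
  by exists a, (dotv a (iota x)); split=> // y sy; apply: Jle => //; exists y.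
have tauw a : a \in J -> tau `<=` wall a.
  by move=> aJ y ty; split; [exact: ts|exact: Jtau].
have spanM' v : v \in dir sigma -> exists u a b,
    u \in dir tau /\ v = u + a *: r2 + b *: r1.
  by move=> /spanM[u [a [b [uE ->]]]]; exists u, b, a; rewrite addrAC.
have wall_dir a r r' : a \in J -> dotv a r = 0 -> dotv a r' < 0 ->
    (forall b, b \in J -> dotv b r <= 0) -> (exists2 b, b \in J & dotv b r < 0) ->
    (forall v, v \in dir sigma ->
      exists u k l, u \in dir tau /\ v = u + k *: r + l *: r') ->
    dir (wall a) = (dir tau + <[r]>)%VS /\ pd (wall a) = (pd tau).+1.
  move=> aJ ar ar' Jr [b bJ br] sp.
  suff e : dir (wall a) = (dir tau + <[r]>)%VS.
    split=> //; rewrite e dim_add_line //; apply/negP => /(JE _ bJ) b0.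
    by move: br; rewrite b0 ltxx.
  apply/eqP; rewrite eqEsubv subv_add; apply/and3P; split.
  - apply: dirsp_min => _ _ [y [sy ay] <-] [z [sz az] <-].
    have [|u [k [l [uE e]]]] := sp (iota y - iota z).
      by apply: dirsp_sub; [exists y|exists z].
    have : dotv a (iota y - iota z) = 0 by rewrite dotvBr ay az subrr.
    rewrite e !dotvDr !dotvZr (JE _ aJ) // ar mulr0 !add0r => /eqP.
    rewrite mulf_eq0 (lt_eqF ar') orbF => /eqP ->.
    by rewrite scale0r addr0 memv_add ?memvZ ?memv_line.
  - by apply: dirsp_mono; apply: image_subset; exact: tauw.
  - rewrite -memvE; have [d d0 [y sy iy]] := Jray _ Jr.
    have : iota y - iota x \in dir (wall a).
      apply: dirsp_sub; last by exists x.
      by exists y => //; split=> //; rewrite iy dotvDr dotvZr ar mulr0 addr0.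
    by rewrite iy addrC addKr rpredZeq gt_eqF.
have ex1 : exists2 b, b \in J & dotv b r1 < 0 by exists a2.
have ex2 : exists2 b, b \in J & dotv b r2 < 0 by exists a1.
have [dir1 dim1] := wall_dir _ _ _ a1J a1r1 a1r2 Jr1 ex1 spanM.
have [dir2 dim2] := wall_dir _ _ _ a2J a2r2 a2r1 Jr2 ex2 spanM'.
exists (wall a1), (wall a2); split.
  move=> e12; have [d d0 [y sy iy]] := Jray _ Jr1.
  have [_] : wall a2 y.
    by rewrite -e12; split=> //; rewrite iy dotvDr dotvZr a1r1 mulr0 addr0.
  rewrite iy dotvDr dotvZr => /eqP; rewrite -subr_eq0 addrC addKr mulf_eq0.
  by rewrite (gt_eqF d0) (lt_eqF a2r1).
move=> rho; split; last first.
  by move=> [] ->; split=> //; try exact: wallP; try exact: tauw; move=> y [].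
move=> [Pr tr rs dr]; have xr := tr _ tx.
have irx : im rho (iota x) by exists x.
have [_ [y ry <-] vE] : exists2 y, im rho y & y - iota x \notin dir tau.
  by apply: dirsp_outside => //; rewrite dr.
have sy := rs _ ry; have [u [k [l [uE e]]]] := spanM _ (dirx _ sy).
have l0 : 0 <= l.
  have := Jv y a1 a1J sy; rewrite e !dotvDr !dotvZr (JE _ a1J) // a1r1 mulr0 !add0r.
  by rewrite nmulr_lle0.
have k0 : 0 <= k.
  have := Jv y a2 a2J sy; rewrite e !dotvDr !dotvZr (JE _ a2J) // a2r2 mulr0 add0r addr0.
  by rewrite nmulr_lle0.
have frs := cx_sub_face cx Pr Ps rs; have [w [c [ws er]]] := frs.
have wrho z : rho z -> dotv w (iota z) = c by rewrite er => -[].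
have wray r : (forall a, a \in J -> dotv a r <= 0) -> dotv w r <= 0.
  move=> Jr; have [d d0 [z sz iz]] := Jray _ Jr.
  by have := ws _ sz; rewrite iz dotvDr dotvZr (wrho x) // gerDl pmulr_rle0.
have wr1 := wray _ Jr1; have wr2 := wray _ Jr2.
have wu : dotv w u = 0.
  apply: (dotv_dirsp0 _ uE) => _ _ [z tz <-] [z' tz' <-].
  by rewrite !wrho //; exact: tr.
(* The form [w] supporting [rho] is nonpositive on both rays, and [k], [l] are nonnegative and not
   both 0; hence [w] vanishes on a ray with positive coefficient. That ray lies in [rho], and
   dimension forces [rho] to be its wall. *)
have ws0 : k * dotv w r1 + l * dotv w r2 = 0.
  have : dotv w (iota y - iota x) = 0 by rewrite dotvBr !wrho // subrr.
  by rewrite e !dotvDr !dotvZr wu add0r.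
have finish a r : a \in J -> dir (wall a) = (dir tau + <[r]>)%VS ->
    pd (wall a) = (pd tau).+1 -> (forall b, b \in J -> dotv b r <= 0) ->
    dotv w r = 0 -> rho = wall a.
  move=> aJ da da1 Jr wr; apply/esym.
  have [d d0 [z sz iz]] := Jray _ Jr.
  have rz : rho z by rewrite er; split=> //; rewrite iz dotvDr dotvZr wr mulr0 addr0 wrho.
  have rr : r \in dir rho.
    have : iota z - iota x \in dir rho by apply: dirsp_sub => //; exists z.
    by rewrite iz addrC addKr rpredZeq gt_eqF.
  have dd : (dir (wall a) <= dir rho)%VS.
    by rewrite da subv_add -memvE rr andbT; apply: dirsp_mono; exact: image_subset.
  have wax : wall a x by apply: (tauw a aJ).
  have sub : wall a `<=` rho.
    move=> y' wy; apply: (face_dir frs xr); first by case: wy.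
    by apply: (subvP dd); apply: dirsp_sub; [exists y'|exists x].
  apply: (face_dim_eq (cx_sub_face cx (wallP _ aJ) Pr sub) wax).
  by rewrite dr da1.
have [kp|kn] := ltrP 0 k.
  left; apply: (finish a1 r1) => //; apply/eqP; rewrite eq_le wr1 /=.
  have : 0 <= k * dotv w r1.
    by rewrite -(addrK (l * dotv w r2) (k * _)) ws0 sub0r oppr_ge0 mulr_ge0_le0.
  by rewrite pmulr_rge0.
have k00 : k = 0 by apply/eqP; rewrite eq_le kn k0.
right; apply: (finish a2 r2) => //; move: ws0; rewrite k00 mul0r add0r => /eqP.
rewrite mulf_eq0 => /orP[/eqP l00|/eqP//]; case/negP: vE.
by rewrite e k00 l00 !scale0r !addr0.
Qed.

(** The four normals lie in the plane of directions of [sigma] orthogonal to [tau]. The identity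
    trades slopes across the [rho] for slopes along them, the exchange behind the balancing of
    [f . c]. *)
Lemma facet_flip Pi sigma tau rho1 rho2 x w : is_cx iota Pi -> Pi sigma ->
  Pi rho1 -> Pi rho2 -> Pi tau -> rho1 <> rho2 ->
  tau `<=` rho1 -> tau `<=` rho2 -> rho1 `<=` sigma -> rho2 `<=` sigma ->
  pd rho1 = (pd tau).+1 -> pd rho2 = (pd tau).+1 -> pd sigma = (pd tau).+2 ->
  tau x -> relpt (im tau) (iota x) ->
  dotv w (nvec iota sigma rho1) *: nvec iota rho1 tau +
  dotv w (nvec iota sigma rho2) *: nvec iota rho2 tau =
  dotv w (nvec iota rho1 tau) *: nvec iota sigma rho1 +
  dotv w (nvec iota rho2 tau) *: nvec iota sigma rho2.
Proof.
move=> cx Ps P1 P2 Pt n12 t1 t2 s1 s2 d1 d2 ds tx rx.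
have x1 := t1 _ tx; have x2 := t2 _ tx.
have ft1 := cx_sub_face cx Pt P1 t1; have ft2 := cx_sub_face cx Pt P2 t2.
have f1s := cx_sub_face cx P1 Ps s1; have f2s := cx_sub_face cx P2 Ps s2.
have [|e11 e1d e1o _] := nvecP ft1 tx; first by rewrite d1.
have [|e22 e2d e2o _] := nvecP ft2 tx; first by rewrite d2.
have [|n11 n1d n1o n1p] := nvecP f1s x1; first by rewrite d1 ds.
have [|n22 n2d n2o n2p] := nvecP f2s x2; first by rewrite d2 ds.
have [a a0 [y1 r1y iy1]] := nvec_ray ft1 (cx_convex cx P1) tx rx d1.
have [b b0 [y2 r2y iy2]] := nvec_ray ft2 (cx_convex cx P2) tx rx d2.
set e1 := nvec iota rho1 tau in e11 e1d e1o iy1 *.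
set e2 := nvec iota rho2 tau in e22 e2d e2o iy2 *.
set m1 := nvec iota sigma rho1 in n11 n1d n1o n1p *.
set m2 := nvec iota sigma rho2 in n22 n2d n2o n2p *.
have lt1 : (dir tau <= dir rho1)%VS by apply: dirsp_mono; exact: image_subset.
have lt2 : (dir tau <= dir rho2)%VS by apply: dirsp_mono; exact: image_subset.
have l1s : (dir rho1 <= dir sigma)%VS by apply: dirsp_mono; exact: image_subset.
have l2s : (dir rho2 <= dir sigma)%VS by apply: dirsp_mono; exact: image_subset.
have ds1 : pd sigma = (pd rho1).+1 by rewrite ds d1.
have basis v : v \in dir sigma -> (forall u, u \in dir tau -> dotv v u = 0) ->
    v = dotv e1 v *: e1 + dotv m1 v *: m1.
  exact: (orth_basis2 lt1 l1s d1 ds1 e1d n1d e11 n11 e1o n1o).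
have E := basis e2 (subvP l2s _ e2d) e2o.
have N : m2 = dotv e1 m2 *: e1 + dotv m1 m2 *: m1.
  by apply: basis => // u ut; apply: n2o; exact: (subvP lt2).
apply: plane_flip => //; try by rewrite dotvC ?n1o ?n2o.
(* Were this product 0, the directions of [rho2] would lie in those of [rho1], making [rho2] a face
   of [rho1] of the same dimension. *)
- rewrite lt_def; apply/andP; split; last first.
    have := n1p _ _ (s2 _ r2y) x1; rewrite iy2 addrC addKr dotvZr.
    by rewrite pmulr_rge0.
  apply/eqP => s0; apply: n12; apply/esym.
  have e2r1 : e2 \in dir rho1 by rewrite E s0 scale0r addr0 memvZ.
  have sub : rho2 `<=` rho1.
    move=> y ry; apply: (face_dir f1s x1); first exact: s2.
    have yx : iota y - iota x \in dir rho2 by apply: dirsp_sub; [exists y|exists x].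
    have := dir_decomp lt2 d2 e2d e22 e2o yx => /(subvP lt1).
    by rewrite rpredBr // memvZ.
  by apply: (face_dim_eq (cx_sub_face cx P2 P1 sub) x2); rewrite d1 d2.
- have := n2p _ _ (s1 _ r1y) x2; rewrite iy1 addrC addKr dotvZr dotvC.
  by rewrite pmulr_rge0.
Qed.

End Diamond.

(** * Weights: balancing of products, positivity of cycles, a criterion for concavity *)

Lemma big_two (V : nmodType) (T : eqType) (r : seq T) (P : pred T) (F : T -> V) a b :
  uniq r -> a \in r -> b \in r -> a != b -> (forall x, P x = (x == a) || (x == b)) ->
  \sum_(x <- r | P x) F x = F a + F b.
Proof.
move=> ur ar br ab Pe; rewrite -big_filter.
have e : perm_eq [seq x <- r | P x] [:: a; b].
  apply: uniq_perm; first exact: filter_uniq.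
    by rewrite /= inE ab.
  move=> x; rewrite mem_filter Pe !inE; apply/andb_idr.
  by case/orP => /eqP ->.
by rewrite (perm_big _ e) /= !big_cons big_nil addr0.
Qed.

Lemma fsum_sub (V : nmodType) (T : choiceType) (r : seq T) (A : set T) (F : T -> V) :
  uniq r -> A `<=` [set` r] ->
  \sum_(i \in A) F i = \sum_(i <- r | i \in A) F i.
Proof.
move=> ur AS; rewrite -{1}(setIidr AS) fsbig_mkcondr -fsbig_seq //=.
by rewrite -big_mkcond.
Qed.

Lemma finite_uniq_seq (T : choiceType) (A : set T) : finite_set A ->
  exists2 r : seq T, uniq r & A = [set` r].
Proof.
move=> /finite_seqP[s ->]; exists (undup s); first exact: undup_uniq.
by apply/seteqP; split=> x /=; rewrite mem_undup.
Qed.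

Section Weights.
Variables (R : realType) (X : topologicalType) (n : nat).
Variable iota : X -> 'rV[R]_n.
Implicit Types (Pi : set (set X)) (sigma tau rho V : set X) (x y z : X).
Implicit Types (u v w p q : 'rV[R]_n) (c : set X -> R).

Notation im sigma := (iota @` sigma).
Notation dir sigma := (dirsp (iota @` sigma)).
Notation pd sigma := (\dim (dirsp (iota @` sigma))).

Lemma star_finite Pi x : is_cx iota Pi ->
  exists2 r : seq (set X), uniq r & [set sigma | Pi sigma /\ sigma x] = [set` r].
Proof.
move=> [_ /(_ x)[N [nN fN]] _ _ _]; apply: finite_uniq_seq.
apply: sub_finite_set fN => sigma [Ps sx]; split=> //; exists x; split=> //.
exact: nbhs_singleton.
Qed.

(** A double sum over flags [tau], [rho], [sigma]. For fixed [sigma] the normals are exchanged by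
    [facet_flip]; then for fixed [rho] the sum over [sigma] is a multiple of the balancing condition
    of [c] at [rho]. *)
Lemma pa_mult_minkowski Pi V k f c : is_cx iota Pi -> open V ->
  is_pa iota Pi V f -> is_minkowski iota Pi V k.+1 c ->
  is_minkowski iota Pi V k (pa_mult iota Pi V k f c).
Proof.
move=> cx oV pf mc j tau kj /restrE[Pt tV dt]; rewrite {}kj in mc *.
have [x [tx Vx rx]] := cx_relpt cx Pt oV tV.
have [r ur rE] := star_finite x cx.
have inr sigma : Pi sigma -> tau `<=` sigma -> sigma \in r.
  by move=> Ps ts; suff : [set` r] sigma by []; rewrite -rE; split=> //; exact: ts.
set A := [set sigma | restr iota Pi V j.+1 sigma /\ face iota tau sigma].
pose B rho := [set sigma | restr iota Pi V j.+2 sigma /\ face iota rho sigma].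
have AP rho : rho \in A <-> [/\ Pi rho, tau `<=` rho & pd rho = j.+1].
  rewrite inE; split=> [[/restrE[Pr _ dr] /face_sub]|[Pr tr dr]] //.
  split; last exact: cx_sub_face cx Pt Pr tr.
  by apply/restrE; split=> //; exists x; split=> //; exact: tr.
have BP rho sigma : rho \in A ->
    sigma \in B rho <-> [/\ Pi sigma, rho `<=` sigma & pd sigma = j.+2].
  move=> /AP[Pr tr dr]; rewrite inE.
  split=> [[/restrE[Ps _ ds] /face_sub]|[Ps rs ds]] //.
  split; last exact: cx_sub_face cx Pr Ps rs.
  by apply/restrE; split=> //; exists x; split=> //; apply: rs; exact: tr.
have Ar : A `<=` [set` r] by move=> rho /mem_set/AP[Pr tr _]; exact: inr.
have Br rho : rho \in A -> B rho `<=` [set` r].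
  move=> rA sigma /mem_set/(BP _ _ rA)[Ps rs _]; apply: inr => //.
  by move/AP: rA => [_ tr _] y /tr; exact: rs.
rewrite (fsum_sub _ ur Ar).
pose L sigma := lin_part iota V f sigma.
pose N sigma rho := nvec iota sigma rho.
have -> : \sum_(rho <- r | rho \in A)
      pa_mult iota Pi V j.+1 f c rho *: N rho tau =
    - \sum_(rho <- r | rho \in A) \sum_(sigma <- r | sigma \in B rho)
        (c sigma * dotv (L sigma) (N sigma rho)) *: N rho tau.
  rewrite -sumrN; apply: eq_bigr => rho rA.
  by rewrite /pa_mult (fsum_sub _ ur (Br _ rA)) scaleNr scaler_suml.
have flip sigma :
    \sum_(rho <- r | (rho \in A) && (sigma \in B rho))
      (c sigma * dotv (L sigma) (N sigma rho)) *: N rho tau =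
    \sum_(rho <- r | (rho \in A) && (sigma \in B rho))
      (c sigma * dotv (L sigma) (N rho tau)) *: N sigma rho.
  (* If [sigma] does not contain [tau] in codimension two, both sums are empty; otherwise each has
     exactly the two terms given by [diamond]. *)
  have [[Ps ts ds]|no] :=
    pselect [/\ Pi sigma, tau `<=` sigma & pd sigma = j.+2]; last first.
    rewrite !big_pred0 // => rho; apply/negP => /andP[rA sB]; apply: no;
      have [_ tr _] := (AP rho).1 rA; have [Ps rs ds] := (BP _ _ rA).1 sB;
      by split=> // y /tr; exact: rs.
  have [|rho1 [rho2 [/eqP n12 h12]]] := diamond cx Ps Pt ts tx rx.
    by rewrite ds dt.
  have [P1 t1 s1 d1] := (h12 rho1).2 (or_introl erefl).
  have [P2 t2 s2 d2] := (h12 rho2).2 (or_intror erefl).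
  have predE rho : (rho \in A) && (sigma \in B rho) = (rho == rho1) || (rho == rho2).
    apply/andP/orP => [[rA sB]|h].
      have [Pr tr dr] := (AP rho).1 rA; have [_ rs _] := (BP _ _ rA).1 sB.
      by have [->|->] := (h12 rho).1 (And4 Pr tr rs (etrans dr (congr1 S (esym dt))));
        [left|right].
    have [Pr tr rs dr] :
        [/\ Pi rho, tau `<=` rho, rho `<=` sigma & pd rho = (pd tau).+1].
      by apply/h12; case: h => /eqP ->; [left|right].
    have rA : rho \in A by apply/AP; split=> //; rewrite dr dt.
    by split=> //; apply/BP.
  rewrite !(big_two _ ur (inr _ P1 t1) (inr _ P2 t2) n12 predE) -!scalerA -!scalerDr.
  congr (_ *: _).
  by apply: (facet_flip (x := x) _ cx Ps P1 P2 Pt (elimN eqP n12)) => //;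
    rewrite ds dt.
rewrite (exchange_big_dep xpredT) //=.
under eq_bigr => sigma _ do rewrite flip.
rewrite -(exchange_big_dep xpredT (P := fun rho => rho \in A)
  (Q := fun rho sigma => sigma \in B rho)
  (F := fun rho sigma => (c sigma * dotv (L sigma) (N rho tau)) *: N sigma rho)) //=.
rewrite big1 ?oppr0 // => rho rA; have [Pr tr dr] := (AP rho).1 rA.
have rV : rho `&` V !=set0 by exists x; split=> //; exact: tr.
have dtr : (pd tau < pd rho)%N by rewrite dr dt.
have [_ nr _ _] := nvecP (cx_sub_face cx Pt Pr tr) tx dtr.
(* The normal of [rho] over [tau] is a direction of [rho], so the form of [sigma] may be replaced by
   that of [rho] and the factor leaves the sum. *)
transitivity (dotv (L rho) (N rho tau) *:
    \sum_(sigma <- r | sigma \in B rho) c sigma *: N sigma rho).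
  rewrite scaler_sumr; apply: eq_bigr => sigma sB.
  have [Ps rs _] := (BP _ _ rA).1 sB.
  by rewrite scalerA mulrC (lin_part_face cx oV pf Pr Ps rs rV nr).
rewrite -(fsum_sub _ ur (Br _ rA)) (mc j.+1 rho) ?scaler0 //.
by apply/restrE.
Qed.

(** A cell of [Pi'] inside [sigma] is enlarged one dimension at a time: while directions of [sigma]
    are missing, a segment leaving the cell starts in another cell of [Pi'], whose intersection with
    [sigma] contains the old cell and a new direction. *)
Lemma subdivision_cell Pi' Pi V k sigma : subdivides iota Pi' Pi -> open V ->
  restr iota Pi V k sigma ->
  exists2 sigma', restr iota Pi' V k sigma' & sigma' `<=` sigma.
Proof.
move=> sd oV /restrE[Ps sV ds]; have [cx' cx sub] := sd.
have cs := cx_convex cx Ps.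
(* [s] lies in some [s2] of [Pi], and the form cutting the face [s2]&[sigma] out of [s2] cuts a face
   out of [s]. *)
have inter s x : Pi' s -> s x -> sigma x -> Pi' (s `&` sigma).
  move=> Ps' sx sgx; have [s2 [Ps2 ss2]] := sub _ Ps'.
  have [_ _ _ _ hi] := cx; have [[w [c [wle e]]] _] := hi _ _ Ps2 Ps.
  have [_ _ _ hf _] := cx'; apply: (hf s) => //; exists w, c.
  split; first by move=> y /ss2; exact: wle.
  apply/seteqP; split=> y [sy h]; split=> //.
    by have : (s2 `&` sigma) y; [split=> //; exact: ss2|rewrite e => -[]].
  by have [] : (s2 `&` sigma) y by rewrite e; split=> //; exact: ss2.
suff H d : (d <= k)%N -> exists s x, [/\ Pi' s, s `<=` sigma, (d <= pd s)%N &
    [/\ s x, V x & relpt (im sigma) (iota x)]].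
  have [s [x [Ps' ss dk [sx Vx _]]]] := H k (leqnn _); exists s => //.
  apply/restrE; split=> //; first by exists x.
  by apply/eqP; rewrite eqn_leq dk andbT -ds; exact: subset_dir_dim.
elim: d => [_|d IH dk].
  have [x [sx Vx rx]] := cx_relpt cx Ps oV sV.
  have [cov _ _ _ _] := cx'; have [s [Ps' s'x]] := cov x.
  by exists (s `&` sigma), x; split=> //; exact: inter s'x sx.
have [s [x0 [Ps' ss ds' [sx0 Vx0 rx0]]]] := IH (ltnW dk).
have [|dle] := ltnP d (pd s); first by move=> lt; exists s, x0.
have cs' := cx_convex cx' Ps'.
(* A short step from [x0] towards a relative interior point of [s] stays in [V] and is relatively
   interior to both [s] and [sigma]. *)
have [x [sx Vx rx rsx]] : exists x, [/\ s x, V x, relpt (im s) (iota x) &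
    relpt (im sigma) (iota x)].
  have [q [q' sq' <-] rq] : exists2 q, im s q & relpt (im s) q.
    have [|q rq] := relpt_exists cs'; first by exists (iota x0), x0.
    by exists q => //; case: rq.
  have [|e e0 he] := cx_ray (v := iota q' - iota x0) (d := 1) cx' Ps' oV Vx0 sx0 ltr01.
    by rewrite scale1r addrC subrK; exists q'.
  pose t := Num.min (2^-1) e; have t0 : 0 < t by rewrite lt_min e0 invr_gt0 ltr0n.
  have t1 : t < 1 by rewrite gt_min invf_lt1 ?ltr1n.
  have [|y [sy Vy iy]] := he t (ltW t0); first by rewrite ge_min lexx orbT.
  exists y; split=> //; rewrite iy.
    by apply: relpt_move => //; exact: ltW.
  have -> : iota x0 + t *: (iota q' - iota x0) =
      iota q' + (1 - t) *: (iota x0 - iota q').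
    by apply/rowP => i; rewrite !mxE; ring.
  apply: relpt_move => //; first by exists q' => //; exact: ss.
    by rewrite subr_gt0.
  by rewrite gerBl ltW.
have [_ [y sy <-] yN] : exists2 y, im sigma y & y - iota x \notin dir s.
  apply: dirsp_outside; first by exists x => //; exact: ss.
  by rewrite ds (leq_ltn_trans dle).
have [|gam [gg hg]] := germ_exists (v := iota y - iota x) (d := 1) cx Ps (ss _ sx) ltr01.
  by rewrite scale1r addrC subrK; exists y.
have [g0 [s2 [e [Ps2 e0 he]]]] := germ_sub sd gg.
have s2x : s2 x by rewrite -g0; exact: (he 0 (lexx _) (ltW e0)).1.
exists (s2 `&` sigma), x; split=> //.
- exact: inter s2x (ss _ sx).
(* A face of [s] through the relative interior point [x] is all of [s]. *)
- have ss2 : s `<=` s2 `&` sigma.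
    have [_ _ _ _ hi] := cx'; have [_ fs] := hi _ _ Ps2 Ps'.
    have sub2 := face_relpt fs cs' (conj s2x sx) rx.
    by move=> z sz; split; [exact: (sub2 _ sz).1|exact: ss].
  apply: leq_ltn_trans ds' _; rewrite ltnNge; apply/negP => ge.
  have /eqP eqd : dir s == dir (s2 `&` sigma).
    by rewrite eqEdim ge andbT; apply: dirsp_mono; exact: image_subset.
  case/negP: yN; pose t := Num.min e 1.
  have t0 : 0 < t by rewrite lt_min e0 ltr01.
  have te : t <= e by rewrite ge_min lexx.
  have t1 : t <= 1 by rewrite ge_min lexx orbT.
  have [s2g ig] := he t (ltW t0) te; have [sg _] := hg t (ltW t0) t1.
  have : iota (gam t) - iota x \in dir (s2 `&` sigma).
    by apply: dirsp_sub; [exists (gam t)|exists x => //; split=> //; exact: ss].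
  by rewrite ig addrC addKr -eqd rpredZeq gt_eqF.
- by split=> //; split=> //; exact: ss.
Qed.

Lemma cx_full_sub Pi sigma sigma' rho : is_cx iota Pi -> Pi sigma -> Pi sigma' ->
  rho !=set0 -> rho `<=` sigma -> rho `<=` sigma' -> pd sigma = pd rho ->
  pd sigma' = pd rho -> sigma = sigma'.
Proof.
move=> cx Ps Ps' [x rx] rs rs' d d'; have [_ _ _ _ hi] := cx.
have [f f'] := hi _ _ Ps Ps'.
have xi : (sigma `&` sigma') x by split; [exact: rs|exact: rs'].
have dd : (pd rho <= pd (sigma `&` sigma'))%N.
  by apply: subset_dir_dim => y ry; split; [exact: rs|exact: rs'].
by rewrite -(face_dim_eq f xi) ?d // [LHS](face_dim_eq f' xi) ?d'.
Qed.

(** Values of a pullback are values of [c] or 0. Conversely every value of [c] on a cell in question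
    is attained: [sigma] contains a cell of [Pi'] of full dimension, and by [cx_full_sub] no other
    [k]-cell of [Pi] contains it. *)
Lemma pullback_positive V k Pi c Pi' c' : open V ->
  is_pullback iota V k Pi c Pi' c' ->
  positive_weight iota Pi V k c <-> positive_weight iota Pi' V k c'.
Proof.
move=> oV [sd h]; split=> pos sigma rs.
  have [[sigma2 [P2 /= [n2 d2] ss ->]]|[_ ->]//] := h _ rs.
  apply: pos; split=> //; split=> //.
  by have [_ [[y [sy Vy]] _]] := rs; exists y; split=> //; exact: ss.
have [sigma' rs' ss] := subdivision_cell sd oV rs.
have [Ps sV ds] := (restrE _ _ _ _ _).1 rs.
have [Ps' sV' ds'] := (restrE _ _ _ _ _).1 rs'.
have ne' : sigma' !=set0 by have [y [sy _]] := sV'; exists y.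
have [[sigma2 [P2 [_ /has_dimE d2] ss2 e]]|[no _]] := h _ rs'; last first.
  by case: no; exists sigma; split=> //; case: rs => _ [].
have [_ cx _] := sd; have e2 := cx_full_sub cx Ps P2 ne' ss ss2.
by rewrite e2 ?ds ?d2 ?ds' // -e; exact: pos.
Qed.

Lemma cyc_equiv_positive V k Pi c Pi' c' : open V ->
  cyc_equiv iota V k (Pi, c) (Pi', c') ->
  positive_weight iota Pi V k c <-> positive_weight iota Pi' V k c'.
Proof.
move=> oV; rewrite /cyc_equiv.
suff H (a b : set (set X) * (set X -> R)) : clos_refl_sym_trans _
    (fun a b => is_pullback iota V k a.1 a.2 b.1 b.2) a b ->
    positive_weight iota a.1 V k a.2 <-> positive_weight iota b.1 V k b.2 by move/H.
elim=> [{}a {}b /(pullback_positive oV)|{}a|{}a {}b _ ->|{}a {}b d _ h1 _ h2] //.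
by rewrite h1.
Qed.

(* It suffices to have, at every point, a linear function dominating f along
   all segments issuing from that point: the linear terms cancel by balancing. *)
Lemma concave_criterion Pi U f : is_cx iota Pi ->
  (forall x, U x -> exists L, forall v gam, germ iota Pi x v gam ->
    exists2 e : R, 0 < e & forall t, 0 <= t -> t <= e ->
      f (gam t) <= f x + t * dotv L v) ->
  concave_pa iota Pi U f.
Proof.
move=> cx0 hf V oV VU k Pi1 c ss pf mc [Pi2 [c2 [ce _ pos2]]].
have cx : is_cx iota Pi1 by apply/(same_space_cx ss).
(* Positivity is given on some representative; the estimate needs it cell by cell on [Pi1]. *)
have pos := (cyc_equiv_positive oV ce).2 pos2.
exists Pi1, (pa_mult iota Pi1 V k f c); split; first exact: rst_refl.
  exact: pa_mult_minkowski.
move=> tau /[dup] rtau /restrE[Pt tV dt].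
have [x [tx Vx rx]] := cx_relpt cx Pt oV tV.
have [r ur rE] := star_finite x cx.
have [L hL] := hf x (VU _ Vx).
set A := [set sigma | restr iota Pi1 V k.+1 sigma /\ face iota tau sigma].
have Ar : A `<=` [set` r].
  by move=> sigma [/restrE[Ps _ _] /face_sub ts]; rewrite -rE; split=> //; exact: ts.
have bal := mc k tau erefl rtau.
rewrite /pa_mult oppr_ge0 -/A (fsum_sub _ ur Ar).
rewrite -/A (fsum_sub _ ur Ar) in bal.
rewrite [leRHS](_ : 0 = \sum_(sigma <- r | sigma \in A)
    c sigma * dotv L (nvec iota sigma tau)); last first.
  rewrite -[LHS](dotv0r L) -[X in dotv L X]bal dotv_sumr.
  by apply: eq_bigr => sigma _; rewrite dotvZr.
apply: ler_sum => sigma; rewrite inE => -[rsigma fts].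
have [Ps sV ds] := (restrE _ _ _ _ _).1 rsigma.
apply: ler_wpM2l; first exact: pos.
have sx := face_sub fts tx.
have [|d d0 sd] := nvec_ray fts (cx_convex cx Ps) tx rx; first by rewrite ds dt.
have [gam [gg hg]] := germ_exists cx Ps sx d0 sd.
have [e1 e10 he1] := germ_open cx gg oV Vx.
have [e2 e20 he2] := hL _ _ ((same_space_germ _ _ _ ss).1 gg).
pose t := Num.min d (Num.min e1 e2).
have t0 : 0 < t by rewrite !lt_min d0 e10.
have td : t <= d by rewrite ge_min lexx.
have te1 : t <= e1 by rewrite !ge_min lexx orbT.
have te2 : t <= e2 by rewrite !ge_min lexx !orbT.
have [sg ig] := hg t (ltW t0) td.
have := he2 t (ltW t0) te2.
rewrite (lin_partP pf Ps sV sg (he1 t (ltW t0) te1)) (lin_partP pf Ps sV sx Vx).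
by rewrite ig dotvDr dotvZr lerD2l ler_pM2l.
Qed.

End Weights.

(** * Closed cells of a hyperplane arrangement *)

Section Arrangement.
Variables (R : realType) (n m : nat) (H : 'I_m -> 'rV[R]_n).
Implicit Types (u v w p q x y : 'rV[R]_n) (s : {ffun 'I_m -> 'I_3}).

(** Signs are coded by ['I_3] so that sign vectors form a finite type; the values are -1, 0 and
    1. *)
Definition sgv (k : 'I_3) : R := (k : nat)%:R - 1.

Lemma sgv_norm k : `|sgv k| <= 1.
Proof.
rewrite /sgv ler_norml; case: k => -[|[|[|//]]] /= _; lra.
Qed.

Lemma sgv_surj (a : R) : exists k, sgv k = Num.sg a.
Proof.
have [a0|a0|->] := ltgtP a 0.
- by exists (inord 0); rewrite ltr0_sg // /sgv inordK // sub0r.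
- by exists (inord 2); rewrite gtr0_sg // /sgv inordK //; lra.
- by exists (inord 1); rewrite sgr0 /sgv inordK // subrr.
Qed.

(** Sign 1 or -1 gives a closed half-space, sign 0 the hyperplane. In this form each absolute value
    is visibly linear on a cell. *)
Definition cell s : set 'rV[R]_n :=
  [set y | forall i, `|dotv (H i) y| = sgv (s i) * dotv (H i) y].

Lemma normr_sgvE k (a : R) :
  `|a| = sgv k * a <-> (1 - sgv k) * a <= 0 /\ - (1 + sgv k) * a <= 0.
Proof.
have := sgv_norm k; set e := sgv k; rewrite ler_norml => /andP[e1 e2].
split; first by case: (ger0P a) => a0 h; split; nra.
move=> [h1 h2]; apply/eqP; rewrite eq_le; apply/andP.
by case: (ger0P a) => a0; split; nra.
Qed.

Lemma cell_gt0 s i x : cell s x -> 0 < dotv (H i) x -> sgv (s i) = 1.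
Proof.
move=> /(_ i) + h; rewrite gtr0_norm // => e.
by apply: (mulIf (lt0r_neq0 h)); rewrite -e mul1r.
Qed.

Lemma cell_lt0 s i x : cell s x -> dotv (H i) x < 0 -> sgv (s i) = -1.
Proof.
move=> /(_ i) + h; rewrite ltr0_norm // => e.
by apply: (mulIf (ltr0_neq0 h)); rewrite -e mulN1r.
Qed.

Lemma cell_exists x : exists s, cell s x /\ forall i, sgv (s i) = Num.sg (dotv (H i) x).
Proof.
have [s hs] := choice (fun i => sgv_surj (dotv (H i) x)).
exists [ffun i => s i]; split=> i; rewrite ffunE hs //.
by rewrite normrEsg.
Qed.

Lemma cell_polyhedron s : is_polyhedron (cell s).
Proof.
pose l1 := [seq ((1 - sgv (s i)) *: H i, 0 : R) | i <- enum 'I_m].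
pose l2 := [seq (- (1 + sgv (s i)) *: H i, 0 : R) | i <- enum 'I_m].
exists (l1 ++ l2); apply/seteqP; split=> y /= hy.
  move=> ab; rewrite mem_cat => /orP[] /mapP[i _ ->] /=; rewrite dotvZl;
    by have [] := (normr_sgvE _ _).1 (hy i).
move=> i; apply/normr_sgvE; split.
  have := hy ((1 - sgv (s i)) *: H i, 0); rewrite /= dotvZl; apply.
  by rewrite mem_cat; apply/orP; left; apply/mapP; exists i => //; rewrite mem_enum.
have := hy (- (1 + sgv (s i)) *: H i, 0); rewrite /= dotvZl; apply.
by rewrite mem_cat; apply/orP; right; apply/mapP; exists i => //; rewrite mem_enum.
Qed.

(** Forms nonzero at [x] keep their sign for a short time; those zero at [x] are constant along
    [v]. *)
Lemma cell_ray s x v : cell s x ->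
  (forall i, dotv (H i) x = 0 -> dotv (H i) v = 0) ->
  exists2 d : R, 0 < d & forall t, 0 <= t -> t <= d -> cell s (x + t *: v).
Proof.
move=> sx xv; have [|||d d0 hd] := finite_uniform_lt (A := [set: 'I_m])
    (P := fun i d => forall t, 0 <= t -> t <= d ->
      `|dotv (H i) (x + t *: v)| = sgv (s i) * dotv (H i) (x + t *: v)).
- exact: finite_finset.
- by move=> i d d' d'0 dd' h t t0 td; apply: h => //; exact: le_trans dd'.
- move=> i _; have [hx|hx|hx] := ltgtP (dotv (H i) x) 0; last first.
    by exists 1 => // t _ _; rewrite dotvDr dotvZr hx xv // mulr0 addr0 normr0 mulr0.
  + have k0 : 0 < 1 + `|dotv (H i) v| by rewrite ltr_pwDl.
    exists (dotv (H i) x / (1 + `|dotv (H i) v|)); first by rewrite divr_gt0.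
    move=> t t0; rewrite ler_pdivlMr // => h.
    rewrite (cell_gt0 sx hx) mul1r ger0_norm // dotvDr dotvZr.
    have := ler_norm (- dotv (H i) v); rewrite normrN => hn; nra.
  + have k0 : 0 < 1 + `|dotv (H i) v| by rewrite ltr_pwDl.
    exists (- dotv (H i) x / (1 + `|dotv (H i) v|)).
      by rewrite divr_gt0 // oppr_gt0.
    move=> t t0; rewrite ler_pdivlMr // => h.
    rewrite (cell_lt0 sx hx) mulN1r ler0_norm // dotvDr dotvZr.
    have := ler_norm (dotv (H i) v) => hn; nra.
- by exists d => // t t0 td i; exact: hd.
Qed.

End Arrangement.

(** * Subdivision of a complex by an arrangement *)

Section Refinement.
Variables (R : realType) (X : topologicalType) (n m : nat).
Variables (iota : X -> 'rV[R]_n) (H : 'I_m -> 'rV[R]_n).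
Implicit Types (Pi : set (set X)) (sigma tau rho V : set X) (x y z : X).
Implicit Types (u v w p q : 'rV[R]_n) (s : {ffun 'I_m -> 'I_3}).

Notation im sigma := (iota @` sigma).

Definition piece sigma s := [set x | sigma x /\ cell H s (iota x)].

Definition refine Pi : set (set X) :=
  [set sigma' | exists sigma s, Pi sigma /\ sigma' = piece sigma s].

Lemma im_piece sigma s : im (piece sigma s) = im sigma `&` cell H s.
Proof.
apply/seteqP; split=> [_ [x [sx cx] <-]|_ [[x sx <-] cx]].
  by split=> //; exists x.
by exists x.
Qed.

Lemma polyhedronI (S T : set 'rV[R]_n) : is_polyhedron S -> is_polyhedron T ->
  is_polyhedron (S `&` T).
Proof.
move=> [s1 ->] [s2 ->]; exists (s1 ++ s2); apply/seteqP; split=> y /=.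
  by move=> [h1 h2] ab; rewrite mem_cat => /orP[/h1|/h2].
move=> h; split=> ab abs; apply: h; rewrite mem_cat abs ?orbT //.
Qed.

Lemma dotv_continuous w : continuous (fun y : 'rV[R]_n => dotv w y).
Proof.
move=> y; apply: (@cvg_big _ _ _ _ _ _ _ (nbhs y)) => [|i _].
  exact: pseudometric_normed_Zmodule.add_continuous.
apply: cvgM; first exact: cvg_cst.
exact: coord_continuous.
Qed.

Lemma polyhedron_closed (S : set 'rV[R]_n) : is_polyhedron S -> closed S.
Proof.
move=> [s ->]; have -> : [set y | forall ab, ab \in s -> dotv ab.1 y <= ab.2] =
    \bigcap_(ab in [set` s]) [set y | dotv ab.1 y <= ab.2] by [].
apply: closed_bigI => ab _.
by apply: (closed_comp (f := dotv ab.1) (D := [set t | t <= ab.2]));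
  [move=> y _; exact: dotv_continuous | exact: closed_le].
Qed.

(** On a piece with signs [s1], the subtracted form is the sum of the absolute values of those forms
    whose signs differ in [s1] and [s2]. It is nonnegative and vanishes exactly on the cell of [s2],
    so the new maximum is reached where both conditions hold. *)
Lemma piece_face sigma1 sigma2 s1 s2 : face iota (sigma1 `&` sigma2) sigma1 ->
  face iota (piece sigma1 s1 `&` piece sigma2 s2) (piece sigma1 s1).
Proof.
move=> [w [c [ws e]]].
pose k i : R := (s1 i != s2 i)%:R.
have k0 i : 0 <= k i by rewrite /k ler0n.
exists (w - \sum_i (k i * sgv R (s1 i)) *: H i), c.
have E x : piece sigma1 s1 x ->
    dotv (w - \sum_i (k i * sgv R (s1 i)) *: H i) (iota x) =
    dotv w (iota x) - \sum_i k i * `|dotv (H i) (iota x)|.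
  move=> [sx cx]; rewrite dotvBl dotv_suml; congr (_ - _).
  by apply: eq_bigr => i _; rewrite dotvZl -mulrA -cx.
have S0 x : 0 <= \sum_i k i * `|dotv (H i) (iota x)|.
  by apply: sumr_ge0 => i _; rewrite mulr_ge0.
split.
  move=> x px; rewrite E //; apply: le_trans (ws x px.1).
  by rewrite gerBl.
apply/seteqP; split=> x.
  move=> [p1 [s2x c2x]]; split=> //; rewrite E //.
  have [_ ->] : [set x | sigma1 x /\ dotv w (iota x) = c] x.
    by rewrite -e; split=> //; case: p1.
  rewrite big1 ?subr0 // => i _; rewrite /k; case: eqP => [|/eqP ne]; first by rewrite mul0r.
  rewrite mul1r; have := p1.2 i; rewrite c2x => /eqP; rewrite -subr_eq0 -mulrBl.
  rewrite mulf_eq0 => /orP[|/eqP ->]; last by rewrite mulr0.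
  rewrite /sgv opprB addrA subrK subr_eq0 eqr_nat => /eqP/val_inj s21.
  by rewrite s21 eqxx in ne.
move=> [p1]; rewrite E // => eqc.
have wx : dotv w (iota x) = c.
  apply/eqP; rewrite eq_le; apply/andP; split; first exact: ws p1.1.
  by rewrite -{1}eqc gerBl.
have sum0 : \sum_i k i * `|dotv (H i) (iota x)| = 0.
  by move: eqc; rewrite wx => /eqP; rewrite subr_eq addrC -subr_eq subrr => /eqP.
split=> //; split.
  by have [] : (sigma1 `&` sigma2) x by rewrite e; split=> //; case: p1.
move=> i; have [s12|ne] := eqVneq (s1 i) (s2 i); first by rewrite -s12; exact: p1.2.
have nn j : true -> 0 <= k j * `|dotv (H j) (iota x)| by rewrite mulr_ge0.
have := psumr_eq0P nn sum0 isT (i := i).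
by rewrite /k ne mul1r => /eqP; rewrite normr_eq0 => /eqP ->; rewrite normr0 mulr0.
Qed.

(* A nonempty face of a piece is again a piece: take a point x in its relative
   interior, the face of sigma cut out by the constraints active at x, and the
   sign vector of x. *)
Lemma face_piece Pi sigma s tau : is_cx iota Pi -> Pi sigma ->
  face iota tau (piece sigma s) -> refine Pi tau.
Proof.
move=> cx Ps ft; have [w [c [ws e]]] := ft; have [_ _ _ hf _] := cx.
have poly : is_polyhedron (im sigma) by case: cx => _ _ /(_ _ Ps) [].
have [tau0|/set0P[x0 tx0]] := eqVneq tau set0.
  exists set0, s; split; last by rewrite tau0; apply/seteqP; split=> // y [].
  apply: (hf sigma) => //; exists 0, 1; split=> [y _|]; first by rewrite dotv0l.
  apply/seteqP; split=> // y [_]; rewrite dotv0l => /eqP.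
  by rewrite eq_sym oner_eq0.
have cp : convex (im (piece sigma s)).
  apply: polyhedron_convex; rewrite im_piece; apply: polyhedronI => //.
  exact: cell_polyhedron.
have ct : convex (im tau).
  move=> _ _ t [y ty <-] [z tz <-] t0 t1.
  move: (ty) (tz); rewrite e => -[py wy] [pz wz].
  have [||q pq iq] := cp (iota y) (iota z) t _ _ t0 t1.
  - by exists y.
  - by exists z.
  exists q => //; split=> //.
  by rewrite iq dotvDr dotvZr dotvBr wy wz subrr mulr0 addr0.
have [|_ [[x tx <-] rx]] := relpt_exists ct; first by exists (iota x0), x0.
have rel : relpt (im tau) (iota x) by split=> //; exists x.
have [[sx csx] wx] : piece sigma s x /\ dotv w (iota x) = c by move: tx; rewrite e.
have isx : im sigma (iota x) by exists x.
have [J [Jle Jray]] := polyhedron_tangent poly isx.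
have [s' [cx' s'E]] := cell_exists H (iota x).
(* A single supporting form: its maximum [dotv W (iota x)] is reached exactly where all active
   constraints are equalities. *)
pose W := \sum_(a <- J) a.
have JW y : sigma y -> dotv W (iota y) <= dotv W (iota x) /\
    (dotv W (iota y) = dotv W (iota x) <->
     forall a, a \in J -> dotv a (iota y) = dotv a (iota x)).
  move=> sy; have Jy a : a \in J -> dotv a (iota y) <= dotv a (iota x).
    by move=> aJ; apply: Jle => //; exists y.
  rewrite /W !dotv_suml; split; first by rewrite !big_seq; exact: ler_sum.
  split=> [|h]; last by rewrite !big_seq; exact: eq_bigr.
  move=> /eqP; rewrite eq_sym -subr_eq0 -sumrB big_seq psumr_eq0; last first.
    by move=> a aJ; rewrite subr_ge0 Jy.
  by move=> /allP h a aJ; have := h _ aJ; rewrite aJ subr_eq0 => /eqP ->.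
exists [set y | sigma y /\ dotv W (iota y) = dotv W (iota x)], s'; split.
  by apply: (hf sigma) => //; exists W, (dotv W (iota x)); split=> // y /JW[].
have tp y : tau y -> piece sigma s y by rewrite e => -[].
apply/seteqP; split=> y.
  move=> ty; have [sy cy] := tp _ ty; have iy : im tau (iota y) by exists y.
  split; [split=> //; apply/(JW _ sy).2 => a aJ|move=> i].
    apply: (relpt_face_eq ct rel _ erefl iy) => _ [z tz <-].
    by apply: Jle => //; exists z => //; have [] := tp _ tz.
  have sgz z : tau z -> _ := fun tz => (normr_sgvE _ _).1 ((tp _ tz).2 i).
  have [hx|hx|hx] := ltgtP (dotv (H i) (iota x)) 0.
  - by rewrite cy s'E ltr0_sg // (cell_lt0 csx hx).
  - by rewrite cy s'E gtr0_sg // (cell_gt0 csx hx).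
  - have h1 : dotv ((1 - sgv R (s i)) *: H i) (iota y) = 0.
      apply: (relpt_face_eq ct rel _ _ iy); last by rewrite dotvZl hx mulr0.
      by move=> _ [z /sgz[hz _] <-]; rewrite dotvZl.
    have h2 : dotv (- (1 + sgv R (s i)) *: H i) (iota y) = 0.
      apply: (relpt_face_eq ct rel _ _ iy); last by rewrite dotvZl hx mulr0.
      by move=> _ [z /sgz[_ hz] <-]; rewrite dotvZl.
    have -> : dotv (H i) (iota y) = 0 by rewrite !dotvZl in h1 h2; lra.
    by rewrite normr0 mulr0.
move=> [[sy Wy] cy].
have h0 i : dotv (H i) (iota x) = 0 -> dotv (H i) (iota y) = 0.
  by move=> hx; have := cy i; rewrite s'E hx sgr0 mul0r => /eqP; rewrite normr_eq0 => /eqP.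
have py : piece sigma s y.
  split=> // i; have [hx|hx|hx] := ltgtP (dotv (H i) (iota x)) 0.
  - by rewrite cy s'E ltr0_sg // (cell_lt0 csx hx).
  - by rewrite cy s'E gtr0_sg // (cell_gt0 csx hx).
  - by rewrite h0 // normr0 mulr0.
rewrite e; split=> //; apply/eqP; rewrite eq_le ws //=.
(* A short step from [x] away from [y] stays in the piece, so the form [w], maximal at [x], cannot
   be smaller at [y]. *)
have [|d1 d10 hd1] := Jray (iota x - iota y).
  by move=> a aJ; rewrite dotvBr ((JW _ sy).2.1 Wy) // subrr.
have [|d2 d20 hd2] := cell_ray (v := iota x - iota y) csx.
  by move=> i hx; rewrite dotvBr hx h0 // subrr.
pose d := Num.min d1 d2; have d0 : 0 < d by rewrite lt_min d10.
have [z sz iz] : im sigma (iota x + d *: (iota x - iota y)).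
  apply: (convex_ray (a := 0) (b := d1) (polyhedron_convex poly)) => //.
  - by rewrite scale0r addr0.
  - exact: ltW.
  - by rewrite ge_min lexx.
have pz : piece sigma s z.
  by split=> //; rewrite iz; apply: hd2; [exact: ltW|rewrite ge_min lexx orbT].
have := ws _ pz; rewrite iz dotvDr dotvZr dotvBr wx gerDl pmulr_rle0 //.
by rewrite subr_le0.
Qed.

Lemma refine_cx Pi : is_cx iota Pi -> is_cx iota (refine Pi).
Proof.
move=> cx; have [cov lf pl hf hi] := cx; split.
- move=> x; have [sigma [Ps sx]] := cov x; have [s [cs _]] := cell_exists H (iota x).
  by exists (piece sigma s); split=> //; exists sigma, s.
- move=> x; have [N [nN fN]] := lf x; exists N; split=> //.
  set A := [set sigma | _] in fN.
  apply: (@sub_finite_set _ _ ((fun a => piece a.1 a.2) @`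
      (A `*` [set: {ffun 'I_m -> 'I_3}]))).
    move=> _ [[sigma [s [Ps ->]]] [y [[sy cy] Ny]]]; exists (sigma, s) => //.
    by split=> //; split=> //; exists y.
  by apply: finite_image; apply: finite_setX => //; exact: finite_finset.
- move=> _ [sigma [s [Ps ->]]]; have [cs [inj [ct ho]] po] := pl _ Ps; split.
  (* [iota] is continuous only within [sigma]; points off [sigma] are treated by closedness of
     [sigma] itself. *)
  + rewrite -[piece _ _]setCK; apply: open_closedC; rewrite openE => x nx.
    rewrite /interior; have [sx|nsx] := pselect (sigma x); last first.
      apply: (@filterS _ _ _ (~` sigma)); first by move=> y ny [].
      by apply: open_nbhs_nbhs; split=> //; exact: closed_openC.
    have oc : open (~` cell H s).
      by apply: closed_openC; apply: polyhedron_closed; exact: cell_polyhedron.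
    have nc : (~` cell H s) (iota x) by move=> cx'; apply: nx.
    have /subspace_continuousP/(_ x sx) := ct.
    move=> /(_ (~` cell H s)) /(_ (open_nbhs_nbhs (conj oc nc))).
    rewrite /nbhs /= /within /=; apply: filterS => y hy [sy cy].
    exact: hy sy cy.
  + split; first by move=> x y [sx _] [sy _]; exact: inj.
    split; first by apply: continuous_subspaceW ct => x [].
    move=> A oA; have [B [oB hB]] := ho A oA; exists B; split=> //.
    rewrite im_piece setIA -hB; apply/seteqP; split.
      by move=> _ [x [Ax [sx cx']] <-]; split=> //; exists x.
    by move=> _ [[x [Ax sx] <-] cx']; exists x.
  + by rewrite im_piece; apply: polyhedronI => //; exact: cell_polyhedron.
- by move=> _ tau [sigma [s [Ps ->]]]; exact: face_piece.
- move=> _ _ [sigma1 [s1 [P1 ->]]] [sigma2 [s2 [P2 ->]]].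
  have [f1 f2] := hi _ _ P1 P2; split; first exact: piece_face.
  by rewrite setIC; apply: piece_face; rewrite setIC.
Qed.

Lemma refine_subdivides Pi : is_cx iota Pi -> subdivides iota (refine Pi) Pi.
Proof.
move=> cx; split=> //; first exact: refine_cx.
by move=> _ [sigma [s [Ps ->]]]; exists sigma; split=> // x [].
Qed.

End Refinement.

(** * Comparison of linear parts and the concave decomposition *)

Section Decomposition.
Variables (R : realType) (X : topologicalType) (n m : nat).
Variables (iota : X -> 'rV[R]_n) (H : 'I_m -> 'rV[R]_n) (w0 : 'rV[R]_n).
Variables (Pi : set (set X)) (U : set X).
Implicit Types (sigma tau rho V : set X) (x y z : X).
Implicit Types (u v w p q : 'rV[R]_n) (s : {ffun 'I_m -> 'I_3}) (g : X -> R).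

Notation im sigma := (iota @` sigma).

(* The linear form H i restricts to the affine function ab.1 - ab.2 on the
   hyperplane dotv w0 y = 1. *)
Definition arranges := forall sigma, Pi sigma -> sigma `&` U !=set0 ->
  exists2 l : seq ('rV[R]_n * R),
    im sigma = [set y | forall ab, ab \in l -> dotv ab.1 y <= ab.2] &
    forall ab, ab \in l -> exists i, H i = ab.1 - ab.2 *: w0.

Hypothesis w0P : forall x, dotv w0 (iota x) = 1.
Hypothesis cx : is_cx iota Pi.
Hypothesis oU : open U.
Hypothesis fU : finite_set [set sigma | Pi sigma /\ sigma `&` U !=set0].
Hypothesis HU : arranges.

(** The polyhedron [r1]&[r2] meets [U], so it is cut out by some of the [H i]: those active at [x]
    stay 0 along [v], the others keep their sign because the segment stays in the cell of [s1].
    Using the intersection yields one point [y] of both pieces, not merely two points with equal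
    image. *)
Lemma pieces_overlap sigma1 sigma2 x v : refine iota H Pi sigma1 ->
  refine iota H Pi sigma2 -> sigma1 x -> sigma2 x -> U x -> dotv w0 v = 0 ->
  (forall i, dotv (H i) (iota x) = 0 -> dotv (H i) v = 0) ->
  exists2 d : R, 0 < d & forall t, 0 <= t -> t <= d ->
    exists y, [/\ sigma1 y, sigma2 y & iota y = iota x + t *: v].
Proof.
move=> [r1 [s1 [P1 ->]]] [r2 [s2 [P2 ->]]] [rx1 cx1] [rx2 cx2] Ux wv Hv.
have [d1 d10 h1] := cell_ray cx1 Hv; have [d2 d20 h2] := cell_ray cx2 Hv.
have [_ _ _ hf hi] := cx; have P3 := hf _ _ P1 (hi _ _ P1 P2).1.
have [|l il lH] := HU P3; first by exists x.
exists (Num.min d1 d2); first by rewrite lt_min d10.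
move=> t t0; rewrite le_min => /andP[t1 t2].
have c1 := h1 t t0 t1; have c2 := h2 t t0 t2.
have [y [ry1 ry2] iy] : im (r1 `&` r2) (iota x + t *: v).
  rewrite il /= => ab abl; have [i Hi] := lH ab abl.
  have E (y : 'rV[R]_n) : dotv w0 y = 1 -> (dotv ab.1 y <= ab.2) = (dotv (H i) y <= 0).
    by move=> wy; rewrite Hi dotvBl dotvZl wy mulr1 subr_le0.
  have : im (r1 `&` r2) (iota x) by exists x.
  rewrite il /= => /(_ ab abl).
  rewrite !E ?dotvDr ?dotvZr ?wv ?mulr0 ?addr0 ?w0P //.
  rewrite le_eqVlt => /predU1P[hx|hx]; first by rewrite hx Hv // mulr0 addr0.
  have := c1 i; rewrite (cell_lt0 cx1 hx) mulN1r dotvDr dotvZr => e.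
  by rewrite -oppr_ge0 -e.
by exists y; split=> //; split=> //; rewrite iy.
Qed.

Definition active x := [seq H i | i <- enum [pred i | dotv (H i) (iota x) == 0]].

(** Along any [v] killed by [w0] and the active forms, a short segment lies in both pieces, where
    both linear parts compute [g]; duality then gives the span. *)
Lemma lin_part_span g sigma1 sigma2 x : is_pa iota (refine iota H Pi) U g ->
  refine iota H Pi sigma1 -> refine iota H Pi sigma2 -> sigma1 x -> sigma2 x ->
  U x ->
  lin_part iota U g sigma1 - lin_part iota U g sigma2
    \in vector.span (w0 :: active x).
Proof.
move=> pg P1 P2 x1 x2 Ux; apply: orth_dual => v hv.
have wv : dotv w0 v = 0 by apply: hv; rewrite mem_head.
have Hv i : dotv (H i) (iota x) = 0 -> dotv (H i) v = 0.
  move=> hi; apply: hv; rewrite in_cons; apply/orP; right.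
  by apply/mapP; exists i; rewrite // mem_enum inE hi eqxx.
have [d d0 hd] := pieces_overlap P1 P2 x1 x2 Ux wv Hv.
have rcx := refine_cx H cx.
have [|e e0 he] := cx_ray (v := v) rcx P1 oU Ux x1 d0.
  by have [y [y1 _ iy]] := hd d (ltW d0) (lexx _); exists y.
pose t := Num.min d e; have t0 : 0 < t by rewrite lt_min d0.
have [|y [y1 y2 iy]] := hd t (ltW t0); first by rewrite ge_min lexx.
have [|y' [y1' Uy iy']] := he t (ltW t0); first by rewrite ge_min lexx orbT.
have yy : y' = y by apply: (cx_inj rcx P1) => //; rewrite iy' iy.
rewrite yy in Uy; have U1 : sigma1 `&` U !=set0 by exists x.
have U2 : sigma2 `&` U !=set0 by exists x.
have := lin_partP pg P1 U1 y1 Uy; rewrite (lin_partP pg P2 U2 y2 Uy).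
have := lin_partP pg P1 U1 x1 Ux; rewrite (lin_partP pg P2 U2 x2 Ux).
rewrite iy !dotvDr => -> /addrI; rewrite !dotvZr => /(mulfI (lt0r_neq0 t0)).
by rewrite dotvBl => ->; rewrite subrr.
Qed.

Lemma refine_finite :
  finite_set [set sigma | refine iota H Pi sigma /\ sigma `&` U !=set0].
Proof.
pose A := [set sigma | Pi sigma /\ sigma `&` U !=set0].
apply: (@sub_finite_set _ _ ((fun a => piece iota H a.1 a.2) @`
    (A `*` [set: {ffun 'I_m -> 'I_3}]))).
  move=> _ [[sigma [s [Ps ->]]] [y [[sy cy] Uy]]]; exists (sigma, s) => //.
  by split=> //; split=> //; exists y.
by apply: finite_image; apply: finite_setX => //; exact: finite_finset.
Qed.

(** The constant from [span_dotv_bound] depends only on the two cells and the set of active indices,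
    so a maximum over finitely many triples serves every [x]. *)
Lemma lin_part_bound g : is_pa iota (refine iota H Pi) U g ->
  exists2 C : R, 0 <= C & forall x sigma1 sigma2 v,
    refine iota H Pi sigma1 -> refine iota H Pi sigma2 -> sigma1 x -> sigma2 x ->
    U x -> dotv w0 v = 0 ->
    dotv (lin_part iota U g sigma1) v <= dotv (lin_part iota U g sigma2) v +
      C * \sum_(i | dotv (H i) (iota x) == 0) `|dotv (H i) v|.
Proof.
move=> pg; set A := [set sigma | refine iota H Pi sigma /\ sigma `&` U !=set0].
pose L sigma := lin_part iota U g sigma.
(* Span membership is a premise of [P], so triples that do not satisfy it impose no condition on
   [C]. *)
pose P (a : (set X * set X) * {set 'I_m}) (C : R) :=
  L a.1.1 - L a.1.2 \in vector.span (w0 :: [seq H i | i <- enum a.2]) ->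
  forall v, dotv w0 v = 0 -> dotv (L a.1.1 - L a.1.2) v <=
    C * \sum_(i in a.2) `|dotv (H i) v|.
have [|||C C0 hC] := @finite_uniform_gt R _ ((A `*` A) `*` [set: {set 'I_m}]) P.
- apply: finite_setX; last exact: finite_finset.
  by apply: finite_setX; exact: refine_finite.
- move=> a C C' CC' h sp v wv; apply: le_trans (h sp v wv) _.
  by rewrite ler_wpM2r // sumr_ge0.
- move=> a _; have [sp|nsp] := boolP (L a.1.1 - L a.1.2 \in
    vector.span (w0 :: [seq H i | i <- enum a.2])); last first.
    by exists 0 => sp; rewrite sp in nsp.
  have [C C0 hC] := span_dotv_bound sp; exists C => _ v wv.
  apply: le_trans (ler_norm _) _; apply: le_trans (hC v) _.
  by rewrite big_cons wv normr0 add0r big_map big_enum.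
exists C => // x sigma1 sigma2 v P1 P2 x1 x2 Ux wv.
rewrite -lerBlDl -dotvBl.
have := hC ((sigma1, sigma2), [set i | dotv (H i) (iota x) == 0]%SET) _ _ v wv.
rewrite /= (eq_bigl (fun i => dotv (H i) (iota x) == 0)); last by move=> i; rewrite inE.
apply; first by split=> //; split; (split=> //; exists x).
have := lin_part_span pg P1 P2 x1 x2 Ux; rewrite /active.
by congr (_ \in vector.span (_ :: map _ _)); apply: eq_enum => i; rewrite !inE.
Qed.

Definition arr (x : X) : R := - \sum_i `|dotv (H i) (iota x)|.

Lemma arr_pa C : is_pa iota (refine iota H Pi) U (fun x => C * arr x).
Proof.
move=> _ [sigma [s [Ps ->]]] _.
exists (C *: - \sum_i sgv R (s i) *: H i) => x [sx cs] _.
rewrite dotvZl dotvNl dotv_suml; congr (_ * - _).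
by apply: eq_bigr => i _; rewrite dotvZl cs.
Qed.

(** Where [H i] is nonzero at [x], the absolute value lies above its tangent; where it is zero, its
    value at [y] is exactly [t] times that of [dotv (H i) v]. *)
Lemma arr_below x y v (t : R) : 0 <= t -> iota y = iota x + t *: v ->
  arr y <= arr x - t * (\sum_i Num.sg (dotv (H i) (iota x)) * dotv (H i) v +
    \sum_(i | dotv (H i) (iota x) == 0) `|dotv (H i) v|).
Proof.
move=> t0 iy; rewrite /arr [\sum_(i | _ == 0) _]big_mkcond -big_split /= mulr_sumr.
rewrite -opprD lerN2 -big_split; apply: ler_sum => i _ /=.
rewrite iy dotvDr dotvZr; set h := dotv (H i) (iota x); set k := dotv (H i) v.
have [h0|h0|->] := ltgtP h 0.
- rewrite ltr0_sg // ltr0_norm // addr0 mulN1r mulrN -opprD -normrN.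
  exact: ler_norm.
- by rewrite gtr0_sg // gtr0_norm // addr0 mul1r ler_norm.
- by rewrite sgr0 normr0 mul0r !add0r normrM ger0_norm.
Qed.

(** The error allowed for [g] is exactly what the kink of [C * arr x] removes; the linear terms of
    [arr] are absorbed into the dominating form. *)
Lemma concave_add_arr g (C : R) : 0 <= C ->
  (forall x, U x -> exists L, forall v gam, germ iota (refine iota H Pi) x v gam ->
    exists2 e : R, 0 < e & forall t, 0 <= t -> t <= e ->
      g (gam t) <= g x + t * (dotv L v +
        C * \sum_(i | dotv (H i) (iota x) == 0) `|dotv (H i) v|)) ->
  concave_pa iota Pi U (fun x => g x + C * arr x).
Proof.
move=> C0 hg; apply: concave_criterion => // x Ux; have [L hL] := hg x Ux.
exists (L - C *: \sum_i Num.sg (dotv (H i) (iota x)) *: H i) => v gam gg.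
have rgg := germ_sub (refine_subdivides H cx) gg.
have [e e0 he] := hL v gam rgg; have [_ [sigma [d [Ps d0 hd]]]] := gg.
exists (Num.min d e); first by rewrite lt_min d0.
move=> t t0; rewrite le_min => /andP[td te].
have h1 := he t t0 te; have h2 := arr_below t0 (hd t t0 td).2.
rewrite dotvBl dotvZl dotv_suml.
rewrite (eq_bigr (fun i => Num.sg (dotv (H i) (iota x)) * dotv (H i) v)); last first.
  by move=> i _; rewrite dotvZl.
have h3 := ler_wpM2l C0 h2; apply: le_trans (lerD h1 h3) _.
by rewrite le_eqVlt; apply/orP; left; apply/eqP; ring.
Qed.

Lemma germ_orth x v gam : germ iota (refine iota H Pi) x v gam -> dotv w0 v = 0.
Proof.
move=> [_ [sigma [d [_ d0 hd]]]]; have [_ e] := hd d (ltW d0) (lexx _).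
have : dotv w0 (iota (gam d)) = 1 by exact: w0P.
rewrite e dotvDr w0P dotvZr -[RHS]addr0 => /addrI/eqP.
by rewrite mulf_eq0 (gt_eqF d0) => /eqP.
Qed.

Lemma concave_decomposition g : is_pa iota (refine iota H Pi) U g ->
  exists f1 f2 : X -> R,
    [/\ is_pa iota (refine iota H Pi) U f1, is_pa iota (refine iota H Pi) U f2,
        concave_pa iota Pi U f1, concave_pa iota Pi U f2 &
        forall x, U x -> g x = f1 x - f2 x].
Proof.
move=> pg; have [C C0 hC] := lin_part_bound pg; have rcx := refine_cx H cx.
(* The summand 0 presents the second function as the case [g = 0] of [concave_add_arr]. *)
exists (fun x => g x + C * arr x), (fun x => 0 + C * arr x); split.
- move=> sigma Ps sU; have [w hw] := pg _ Ps sU; have [w' hw'] := arr_pa C Ps sU.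
  by exists (w + w') => x sx Ux; rewrite hw // hw' // dotvDl.
- move=> sigma Ps sU; have [w' hw'] := arr_pa C Ps sU.
  by exists w' => x sx Ux; rewrite add0r hw'.
- apply: concave_add_arr => // x Ux.
  (* Any cell [sigma0] through [x] provides the dominating form: [lin_part_bound] compares it with
     the cell in which the germ runs. *)
  have [cov _ _ _ _] := rcx; have [sigma0 [P0 x0]] := cov x.
  exists (lin_part iota U g sigma0) => v gam gg.
  have [e e0 he] := germ_open rcx gg oU Ux.
  have [g0 [sigma [d [Ps d0 hd]]]] := gg.
  have sx : sigma x by rewrite -g0; apply: (hd 0 (lexx _) (ltW d0)).1.
  exists (Num.min d e); first by rewrite lt_min d0.
  move=> t t0; rewrite le_min => /andP[td te]; have [st it] := hd t t0 td.
  have sU : sigma `&` U !=set0 by exists x.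
  rewrite (lin_partP pg Ps sU st (he t t0 te)) (lin_partP pg Ps sU sx Ux) it.
  rewrite dotvDr dotvZr lerD2l ler_wpM2l //; apply: hC => //.
  exact: germ_orth gg.
- apply: concave_add_arr => // x Ux; exists 0 => v gam _; exists 1 => // t t0 _.
  by rewrite add0r dotv0l add0r mulr_ge0 // mulr_ge0 // sumr_ge0.
- by move=> x _; rewrite add0r addrK.
Qed.

End Decomposition.

(** * Choice of the arrangement and conclusion *)

Lemma arrangement_exists (R : realType) (X : topologicalType) (n : nat)
    (iota : X -> 'rV[R]_n) (w0 : 'rV[R]_n) (Pi : set (set X)) (U : set X) :
  is_cx iota Pi -> finite_set [set sigma | Pi sigma /\ sigma `&` U !=set0] ->
  exists m (H : 'I_m -> 'rV[R]_n), arranges iota H w0 Pi U.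
Proof.
move=> cx /finite_seqP[r rE].
have ex sigma : exists l : seq ('rV[R]_n * R), Pi sigma ->
    iota @` sigma = [set y | forall ab, ab \in l -> dotv ab.1 y <= ab.2].
  have [Ps|nP] := pselect (Pi sigma); last by exists [::].
  by case: cx => _ _ /(_ _ Ps)[_ _ [l ->]] _ _; exists l.
have [L hL] := choice ex.
pose forms := [seq ab.1 - ab.2 *: w0 | ab <- flatten (map L r)].
exists (size forms), (fun i => nth 0 forms i) => sigma Ps sU.
exists (L sigma); first exact: hL.
move=> ab abL; have : ab.1 - ab.2 *: w0 \in forms.
  apply/mapP; exists ab => //; apply/flatten_mapP; exists sigma => //.
  by suff : [set` r] sigma by []; rewrite -rE.
by move=> /(nthP 0)[i ilt <-]; exists (Ordinal ilt).
Qed.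

Theorem theorem4p23 (R : realType) (X : topologicalType) (n : nat)
  (iota : X -> 'rV[R]_n) (Pi : set (set X)) (U : set X) :
  @second_countable X ->
  (exists w : 'rV[R]_n, forall x, dotv w (iota x) = 1) ->
  is_cx iota Pi ->
  open U ->
  finite_set [set sigma | Pi sigma /\ sigma `&` U !=set0] ->
  exists Pi' : set (set X),
    subdivides iota Pi' Pi /\
    forall g : X -> R, is_pa iota Pi' U g ->
      exists f1 f2 : X -> R,
        [/\ is_pa iota Pi' U f1, is_pa iota Pi' U f2,
            concave_pa iota Pi U f1, concave_pa iota Pi U f2 &
            forall x, U x -> g x = f1 x - f2 x].
Proof.
move=> _ [w0 w0P] cx oU fU; have [m [H HU]] := arrangement_exists w0 cx fU.
exists (refine iota H Pi); split; first exact: refine_subdivides.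
by move=> g; exact: (concave_decomposition w0P cx oU fU HU).
Qed.
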